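(* There exists a universal constant $M>0$ such that the following holds. Let $1<p<2$, let $C\in(1,\infty)$, and let $\Omega\subset\mathbb{R}^2$ be a bounded simply-connected domain such that for every $z_1,z_2\in\mathbb{R}^2\setminus\Omega$ there exists a rectifiable curve $\gamma\subset\mathbb{R}^2\setminus\Omega$ connecting $z_1$ and $z_2$ and satisfying $$\int_{\gamma}\mathrm{dist}(z,\partial\Omega)^{1-p}\,\mathrm{d}s(z)\le C\|z_1-z_2\|^{2-p}.$$ Then $$\dim_{\mathcal H}(\partial\Omega)\le 2-\frac{M}{C}.$$
   Context: A domain is a non-empty connected open set. $\dim_{\mathcal H}$ denotes Hausdorff dimension, $\|\cdot\|$ the Euclidean norm, and $\mathrm{d}s$ integration with respect to arc length; $\mathrm{dist}(z,\partial\Omega)^{1-p}$ is understood as $+\infty$ when $z\in\partial\Omega$. The constant $M$ is independent of $p$, $C$ and $\Omega$. *)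

(* Defs.v *)
From mathcomp Require Import all_boot all_order all_algebra.
From mathcomp Require Import all_classical all_reals all_analysis.
Import Order.TTheory GRing.Theory Num.Theory.
Import numFieldNormedType.Exports.

Set Implicit Arguments.
Unset Strict Implicit.
Unset Printing Implicit Defensive.

Local Open Scope classical_set_scope.
Local Open Scope ring_scope.

(* The library norm on row vectors is the sup norm; it is only used here for
   the topology and for boundedness, which do not depend on this choice. *)
Notation plane R := 'rV[R]_2.

Definition enorm (R : realType) (z : plane R) : R :=
  Num.sqrt (\sum_(i < 2) z 0 i ^+ 2).

Definition boundary (T : topologicalType) (A : set T) : set T :=
  closure A `\` interior A.

(* Meaningful only for A nonempty. *)
Definition dist_to (R : realType) (z : plane R) (A : set (plane R)) : R :=
  inf [set enorm (z - a) | a in A].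

Definition path_in (R : realType) (A : set (plane R)) (g : R -> plane R) :
    Prop :=
  {within `[0, 1]%classic, continuous g} /\ (forall t : R, 0 <= t <= 1 -> A (g t)).

Definition domain (T : topologicalType) (A : set T) : Prop :=
  [/\ A !=set0, connected A & open A].

(* Path-connected, and every loop is null-homotopic relative to its base
   point; H (s, t) is the time-t point of the s-th loop of the homotopy. *)
Definition simply_connected (R : realType) (A : set (plane R)) : Prop :=
  (forall x y, A x -> A y ->
     exists g : R -> plane R, [/\ path_in A g, g 0 = x & g 1 = y]) /\
  (forall g : R -> plane R, path_in A g -> g 0 = g 1 ->
     exists H : R * R -> plane R,
       [/\ {within `[0, 1]%classic `*` `[0, 1]%classic, continuous H},
           forall s t : R, 0 <= s <= 1 -> 0 <= t <= 1 -> A (H (s, t)),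
           forall t : R, 0 <= t <= 1 -> H (0, t) = g t,
           forall t : R, 0 <= t <= 1 -> H (1, t) = g 0 &
           forall s : R, 0 <= s <= 1 -> H (s, 0) = g 0 /\ H (s, 1) = g 0]).

(* Analogue of [variation] for plane curves. *)
Definition polygonal_length (R : realType) (a b : R) (g : R -> plane R)
    (s : seq R) : R :=
  let G := g \o nth b (a :: s) in
  \sum_(0 <= n < size s) enorm (G n.+1 - G n).

Definition curve_length (R : realType) (a b : R) (g : R -> plane R) : \bar R :=
  ereal_sup [set (polygonal_length a b g s)%:E | s in itv_partition a b].

Definition rectifiable (R : realType) (g : R -> plane R) : Prop :=
  {within `[0, 1]%classic, continuous g} /\ (curve_length 0 1 g < +oo)%E.

(* Arc-length parametrization of a rectifiable g : [0, 1] -> plane: the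
   position on g at the first time at which length l has been travelled. *)
Definition arc_param (R : realType) (g : R -> plane R) (l : R) : plane R :=
  g (inf [set t : R | 0 <= t <= 1 /\ curve_length 0 t g = l%:E]).

Definition line_integral (R : realType) (g : R -> plane R)
    (f : plane R -> \bar R) : \bar R :=
  (\int[lebesgue_measure]_(l in `[0%R, fine (curve_length 0 1 g)])
     f (arc_param g l))%E.

(* The case split is needed because powR gives 0 `^ (1 - p) = 0. *)
Definition dist_weight (R : realType) (A : set (plane R)) (p : R)
    (z : plane R) : \bar R :=
  if z \in boundary A then +oo%E
  else (dist_to z (boundary A) `^ (1 - p))%:E.

Definition curve_condition (R : realType) (p C : R) (Omega : set (plane R)) :
    Prop :=
  forall z1 z2 : plane R, ~ Omega z1 -> ~ Omega z2 ->
    exists g : R -> plane R,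
      [/\ rectifiable g,
          forall t : R, 0 <= t <= 1 -> ~ Omega (g t),
          g 0 = z1, g 1 = z2 &
          (line_integral g (dist_weight Omega p)
             <= (C * enorm (z1 - z2) `^ (2 - p))%:E)%E].

Definition diameter (R : realType) (U : set (plane R)) : \bar R :=
  ereal_sup [set (enorm (x - y))%:E | x in U & y in U].

(* The empty set has weight 0 also for s = 0, so that a sequence of sets may
   stand for a finite cover. *)
Definition hausdorff_gauge (R : realType) (s : R) (U : set (plane R)) :
    \bar R :=
  if U == set0 then 0%E else (diameter U `^ s)%E.

Definition hausdorff_content (R : realType) (s delta : R)
    (A : set (plane R)) : \bar R :=
  ereal_inf [set (\sum_(0 <= i <oo) hausdorff_gauge s (F i))%E |
    F in [set F : (set (plane R))^nat |
      (forall i, diameter (F i) <= delta%:E)%E /\ A `<=` \bigcup_i F i]].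

Definition hausdorff_measure (R : realType) (s : R) (A : set (plane R)) :
    \bar R :=
  ereal_sup [set hausdorff_content s delta A | delta in [set d : R | 0 < d]].

Definition hausdorff_dim (R : realType) (A : set (plane R)) : \bar R :=
  ereal_inf [set s%:E | s in
    [set s : R | 0 <= s /\ hausdorff_measure s A = 0%E]].

(* Main.v *)
Require Import Defs.
From mathcomp Require Import all_boot all_order all_algebra.
From mathcomp Require Import all_classical all_reals all_analysis.
From mathcomp Require Import measurable_realfun ring lra zify.
Import Order.TTheory GRing.Theory Num.Theory.
Import numFieldNormedType.Exports.

Set Implicit Arguments.
Unset Strict Implicit.
Unset Printing Implicit Defensive.

Local Open Scope classical_set_scope.
Local Open Scope ring_scope.

(** Write E for the boundary of Omega, F for its complement, d for the distance
    to E, and fix an integer N with C <= N <= 2 C.  The theorem rests on one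
    local fact, [level_points_near]: for every x in E and every small t there
    are N points within 128 N t of x, at mutual distance at least 2 t, at which
    d equals 3 t / 4.

    Granted this fact, let V(t) be the area of the t-neighbourhood of E, which
    is measured here by counting points of a fine grid.  Around each of the N
    points, a square of side comparable to t lies in the shell t/2 < d <= t,
    and these squares are disjoint; so inside each disk of radius comparable to
    N t around a point of E, whose area is comparable to N^2 t^2, the shell has
    area at least of order N t^2.  Hence the shell is a fixed multiple of 1 / N
    of the whole neighbourhood, and V(t / 2) <= (1 - c) V(t) with c = c0 / N
    ([near_pts_decay]).  Iterating over all dyadic scales gives a dimension at
    most 2 - c / 2 ([dim_of_level_points]).  That the shell is compared with the
    neighbourhood at the same scale t, and not at the larger scale N t, is what
    makes the gain linear in 1 / C, without a logarithm.

    For the local fact, put rho = 128 N t.  Every small circle centred on E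
    meets E, since it meets both Omega and F, which are connected.  Therefore a
    circle centred on E that contains a point with d >= t also contains a point
    with d = 3 t / 4, and it is enough to find N such circles about one centre,
    with radii at least 2 t apart.

    If the circles about x with radii in a fixed set of N values between rho / 2
    and 66 N t all contain such points, we are done.  Otherwise some circle S in
    that range lies in d < t.  Take points e_0, ..., e_n = e_0 of E that follow
    S at distance less than t, with steps at most 3 t, and join consecutive ones
    by the curves in F which the hypothesis provides.  If each of these curves
    stayed within rho / 8 of its starting point, their union would be a closed
    curve in F that winds once around x, and it would separate the points of
    Omega near x from those far away, although Omega is connected
    ([cycle_meets_path], [enclosed_escape]).  So some curve leaves the disk of
    radius rho / 8 about its starting point e.  Its weighted length is at most
    C (3 t)^(2-p), whereas crossing an annulus of width 2 t inside d < t costs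
    at least 2 t * t^(1-p).  Both sides scale like t^(2-p), so at most
    3 N / 2 of 3 N disjoint annuli about e are crossed inside d < t, whatever p
    is; in the others the curve has a point with d >= t, hence one gets N
    circles about e ([level_points_of_escape]). *)

(** * Planar Euclidean geometry *)

Section EuclideanPlane.
Variable R : realType.
Implicit Types (u v w x y z : plane R) (A : set (plane R)).

Definition mkpt (a b : R) : plane R := \row_(i < 2) (if i == 0 then a else b).

Lemma mkpt0 a b : mkpt a b 0 0 = a. Proof. by rewrite mxE. Qed.
Lemma mkpt1 a b : mkpt a b 0 1 = b. Proof. by rewrite mxE. Qed.

Lemma plane_eq u v : u 0 0 = v 0 0 -> u 0 1 = v 0 1 -> u = v.
Proof.
move=> h0 h1; apply/rowP => i; case: (unliftP ord0 i) => [j ->|-> //].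
by rewrite (ord1 j) (_ : lift _ _ = 1) //; apply/val_inj.
Qed.

Definition dot u v : R := u 0 0 * v 0 0 + u 0 1 * v 0 1.
Definition cross u v : R := u 0 0 * v 0 1 - u 0 1 * v 0 0.

Lemma coordD u v i : (u + v) 0 i = u 0 i + v 0 i. Proof. by rewrite mxE. Qed.
Lemma coordN u i : (- u) 0 i = - u 0 i. Proof. by rewrite mxE. Qed.
Lemma coordB u v i : (u - v) 0 i = u 0 i - v 0 i.
Proof. by rewrite coordD coordN. Qed.
Lemma coordZ (a : R) u i : (a *: u) 0 i = a * u 0 i. Proof. by rewrite mxE. Qed.

Definition coordE := (coordB, coordD, coordN, coordZ, mkpt0, mkpt1).

Lemma enormE z : enorm z = Num.sqrt (dot z z).
Proof.
rewrite /enorm /dot big_ord_recl big_ord1 -!expr2.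
by rewrite (_ : lift ord0 ord0 = 1) //; apply/val_inj.
Qed.

Lemma dot_ge0 z : 0 <= dot z z.
Proof. by rewrite /dot addr_ge0 // -expr2 sqr_ge0. Qed.

Lemma enorm_ge0 z : 0 <= enorm z.
Proof. by rewrite enormE sqrtr_ge0. Qed.

Lemma sqr_enorm z : enorm z ^+ 2 = dot z z.
Proof. by rewrite enormE sqr_sqrtr // dot_ge0. Qed.

Lemma enorm_le z (a : R) : 0 <= a -> (enorm z <= a) = (dot z z <= a ^+ 2).
Proof.
by move=> a0; rewrite -sqr_enorm ler_pXn2r // nnegrE enorm_ge0.
Qed.

Lemma enorm0 : enorm (0 : plane R) = 0.
Proof. by rewrite enormE /dot !mxE !mul0r addr0 sqrtr0. Qed.

Lemma enormN z : enorm (- z) = enorm z.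
Proof. by rewrite !enormE /dot !coordE !mulrNN. Qed.

Lemma enormBC x y : enorm (x - y) = enorm (y - x).
Proof. by rewrite -enormN opprB. Qed.

(** Lagrange's identity, which gives the Cauchy-Schwarz inequality. *)
Lemma dot_cross u v : dot u v ^+ 2 + cross u v ^+ 2 = dot u u * dot v v.
Proof. by rewrite /dot /cross; ring. Qed.

Lemma normr_dot_le u v : `|dot u v| <= enorm u * enorm v.
Proof.
rewrite -(@ler_pXn2r _ 2) ?nnegrE ?mulr_ge0 ?enorm_ge0 //.
by rewrite real_normK ?num_real // exprMn !sqr_enorm -dot_cross lerDl sqr_ge0.
Qed.

Lemma dot_le u v : dot u v <= enorm u * enorm v.
Proof. exact: le_trans (ler_norm _) (normr_dot_le _ _). Qed.

Lemma enormD u v : enorm (u + v) <= enorm u + enorm v.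
Proof.
rewrite enorm_le ?addr_ge0 ?enorm_ge0 //.
have -> : dot (u + v) (u + v) = dot u u + 2 * dot u v + dot v v.
  by rewrite /dot !coordE; ring.
by have := dot_le u v; rewrite -!sqr_enorm; nra.
Qed.

Lemma enorm_tri y x z : enorm (x - z) <= enorm (x - y) + enorm (y - z).
Proof. by rewrite -[x - z](subrKA y) enormD. Qed.

Lemma enorm_eq0 z : enorm z = 0 -> z = 0.
Proof.
move=> h; have := sqr_enorm z; rewrite h expr0n /= /dot => h2.
by apply: plane_eq; rewrite mxE; nra.
Qed.

Lemma coord0_le z : `|z 0 0| <= enorm z.
Proof.
rewrite -(@ler_pXn2r _ 2) ?nnegrE ?enorm_ge0 //.
by rewrite real_normK ?num_real // sqr_enorm /dot -!expr2 lerDl sqr_ge0.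
Qed.

Lemma coord1_le z : `|z 0 1| <= enorm z.
Proof.
rewrite -(@ler_pXn2r _ 2) ?nnegrE ?enorm_ge0 //.
by rewrite real_normK ?num_real // sqr_enorm /dot -!expr2 lerDr sqr_ge0.
Qed.

Lemma enorm_le_sum z : enorm z <= `|z 0 0| + `|z 0 1|.
Proof.
rewrite enorm_le ?addr_ge0 // /dot.
have n2 (a : R) : a * a = `|a| * `|a| by rewrite -!expr2 real_normK ?num_real.
rewrite (n2 (z 0 0)) (n2 (z 0 1)).
by have := normr_ge0 (z 0 0); have := normr_ge0 (z 0 1); nra.
Qed.

(** The sup norm and the Euclidean norm are comparable, so the library
    topology on the plane is the Euclidean one. *)
Lemma norm_le_enorm z : `|z| <= enorm z.
Proof.
rewrite /Num.norm /= mx_normrE; apply/bigmax_leP; split=> [|[i j] _] /=.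
  exact: enorm_ge0.
rewrite (ord1 i); case: (unliftP ord0 j) => [k ->|->]; last exact: coord0_le.
by rewrite (ord1 k) (_ : lift _ _ = 1) ?coord1_le //; apply/val_inj.
Qed.

Lemma coord_le_norm z i : `|z 0 i| <= `|z|.
Proof.
rewrite {2}/Num.norm /= mx_normrE.
by rewrite (@le_bigmax_cond _ _ _ 0 (0, i) xpredT (fun i => `|z i.1 i.2|)).
Qed.

Lemma enorm_le_norm z : enorm z <= 2 * `|z|.
Proof.
apply: le_trans (enorm_le_sum z) _.
by have := coord_le_norm z 0; have := coord_le_norm z 1; lra.
Qed.

Lemma nbhs_enormP x A : nbhs x A <->
  exists2 e : R, 0 < e & forall y, enorm (y - x) < e -> A y.
Proof.
split=> [/nbhs_ballP[e /= e0 xeA]|[e e0 xeA]].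
  exists e => // y yx; apply: xeA; rewrite -ball_normE /ball_ /=.
  by rewrite distrC; apply: le_lt_trans yx; exact: norm_le_enorm.
apply/nbhs_ballP; exists (e / 2) => /=; first by rewrite divr_gt0.
move=> y; rewrite -ball_normE /ball_ /= distrC => yx; apply: xeA.
by apply: le_lt_trans (enorm_le_norm _) _; lra.
Qed.

Lemma closure_enormP A x : closure A x <->
  forall e : R, 0 < e -> exists2 y, A y & enorm (y - x) < e.
Proof.
split=> [cA e e0|cA B /nbhs_enormP[e e0 eB]].
  have /cA[y [Ay yx]] : nbhs x [set y | enorm (y - x) < e].
    by apply/nbhs_enormP; exists e.
  by exists y.
by have [y Ay yx] := cA e e0; exists y; split => //; exact: eB.
Qed.

(** ** Distance to a set *)

Lemma dist_has_inf z A : A !=set0 -> has_inf [set enorm (z - a) | a in A].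
Proof.
move=> [a Aa]; split; first by exists (enorm (z - a)), a.
by exists 0 => _ [b _ <-]; exact: enorm_ge0.
Qed.

Lemma dist_ge0 z A : A !=set0 -> 0 <= dist_to z A.
Proof.
move=> A0; apply: lb_le_inf; first exact: (dist_has_inf z A0).1.
by move=> _ [b _ <-]; exact: enorm_ge0.
Qed.

Lemma dist_le z a A : A a -> dist_to z A <= enorm (z - a).
Proof.
move=> Aa; apply: ge_inf; last by exists a.
by exists 0 => _ [b _ <-]; exact: enorm_ge0.
Qed.

Lemma dist_ltP z A (r : R) : A !=set0 -> dist_to z A < r ->
  exists2 a, A a & enorm (z - a) < r.
Proof.
move=> A0 zr; have e0 : 0 < r - dist_to z A by rewrite subr_gt0.
have [_ [a Aa <-] h] := inf_adherent e0 (dist_has_inf z A0).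
by exists a => //; move: h; rewrite -/(dist_to z A) subrKC.
Qed.

Lemma dist_lip z w A : A !=set0 ->
  dist_to z A <= dist_to w A + enorm (z - w).
Proof.
move=> A0; apply/ler_addgt0Pr => e e0.
have [|a Aa wa] := @dist_ltP w A (dist_to w A + e) A0; first by rewrite ltrDl.
by have := dist_le z Aa; have := enorm_tri w z a; lra.
Qed.

Lemma dist_self z A : A z -> dist_to z A = 0.
Proof.
move=> Az; apply/eqP; rewrite eq_le dist_ge0 ?andbT; last by exists z.
by have := dist_le z Az; rewrite subrr enorm0.
Qed.

Lemma dist_gt0 z A : closed A -> A !=set0 -> ~ A z -> 0 < dist_to z A.
Proof.
move=> cA A0 nAz; rewrite lt_neqAle dist_ge0 // andbT; apply/eqP => d0.
apply: nAz; rewrite (closure_id A).1 //; apply/closure_enormP => e e0.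
have [|a Aa za] := @dist_ltP z A e A0; first by rewrite -d0.
by exists a => //; rewrite enormBC.
Qed.

End EuclideanPlane.

(** * Connectedness, circles and paths *)

Section Topology.
Variable R : realType.
Implicit Types (u v w x y z : plane R) (A B : set (plane R)).

(** The two functions to which this applies are the distance to a set and the
    distance to a point; the one-sided inequality is the form in which the
    triangle inequality gives the Lipschitz bound. *)
Lemma lip_continuous (f : plane R -> R) :
  (forall z w, f z <= f w + enorm (z - w)) -> continuous f.
Proof.
move=> fl z V /nbhs_ballP[e /= e0 eV]; apply/nbhs_enormP; exists e => // y yz.
apply: eV; rewrite -ball_normE /ball_ /= ltr_norml.
by have := fl y z; have := fl z y; rewrite (enormBC z y); lra.
Qed.

Lemma dist_continuous A : A !=set0 -> continuous (fun z : plane R => dist_to z A).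
Proof. by move=> A0; apply: lip_continuous => z w; apply: dist_lip A0. Qed.

Lemma enormB_continuous x : continuous (fun z : plane R => enorm (z - x)).
Proof. by apply: lip_continuous => z w; have := enorm_tri w z x; lra. Qed.

Lemma connected_ivt A (f : plane R -> R) z w (c : R) :
  connected A -> continuous f -> A z -> A w -> f z <= c -> c <= f w ->
  exists2 q, A q & f q = c.
Proof.
move=> cA cf Az Aw zc cw.
have /connected_intervalP iA : connected (f @` A).
  by apply: connected_continuous_connected => //; exact: continuous_subspaceT.
have zcw : f z <= c <= f w by rewrite zc.
have fA y : A y -> (f @` A) (f y) by exists y.
by have [q Aq fq] := iA _ _ (fA _ Az) (fA _ Aw) c zcw; exists q.
Qed.

Lemma closed_boundary (T : topologicalType) (U : set T) : closed (boundary U).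
Proof.
rewrite /boundary setDE; apply: closedI; first exact: closed_closure.
by apply: open_closedC; exact: open_interior.
Qed.

(** Off the boundary, the interior of [U] and the closure of [U] agree, so they
    would cut [K] into an open and closed part. *)
Lemma connected_boundary (T : topologicalType) (U K : set T) (a b : T) :
  connected K -> K a -> K b -> U a -> ~ U b -> exists2 c, K c & boundary U c.
Proof.
move=> cK Ka Kb Ua nUb; apply: contrapT => nc.
have nb c : K c -> closure U c -> interior U c.
  by move=> Kc clU; apply: contrapT => nU; apply: nc; exists c.
suff /(_ b) : forall c, K c -> (K `&` interior U) c.
  by move=> /(_ Kb) [_ /interior_subset].
suff -> : K `&` interior U = K by [].
apply: cK.
- by exists a; split => //; apply: nb => //; exact: subset_closure.
- by exists (interior U) => //; exact: open_interior.
- exists (closure U); first exact: closed_closure.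
  apply/seteqP; split => c [Kc Uc]; split => //; last exact: nb.
  by apply: subset_closure; exact: interior_subset.
Qed.

Definition circ x (r a : R) : plane R := x + r *: mkpt (cos a) (sin a).

Lemma enorm_circ x (r a : R) : 0 <= r -> enorm (circ x r a - x) = r.
Proof.
move=> r0; rewrite /circ addrAC subrr add0r enormE /dot !coordE.
have := cos2Dsin2 a; rewrite !expr2 => cs.
rewrite (_ : _ + _ = r ^+ 2); first by rewrite sqrtr_sqr ger0_norm.
by rewrite expr2; transitivity (r * r * (cos a * cos a + sin a * sin a));
  [ring | rewrite cs mulr1].
Qed.

Lemma unit_angle (a b : R) : a ^+ 2 + b ^+ 2 = 1 ->
  exists t : R, a = cos t /\ b = sin t.
Proof.
move=> ab; have a1 : -1 <= a <= 1 by nra.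
have ca : cos (acos a) = a by rewrite acosK // in_itv.
have sa : sin (acos a) ^+ 2 = b ^+ 2 by rewrite sin2cos2 ca; lra.
move/eqP: sa; rewrite eqf_sqr => /orP[/eqP|/eqP] sab.
  by exists (acos a); rewrite ca sab.
by exists (- acos a); rewrite cosN sinN ca sab opprK.
Qed.

Lemma circ_surj x z (r : R) : 0 < r -> enorm (z - x) = r ->
  exists a, z = circ x r a.
Proof.
move=> r0 zr.
have h : dot (z - x) (z - x) = r ^+ 2 by rewrite -zr sqr_enorm.
have [|a [ac as_]] := @unit_angle ((z - x) 0 0 / r) ((z - x) 0 1 / r).
  by rewrite !expr_div_n -mulrDl !expr2 -/(dot _ _) h expr2 divff ?mulf_neq0 ?gt_eqF.
exists a; rewrite /circ -ac -as_; apply: plane_eq; rewrite !coordE.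
  by rewrite mulrCA divff ?gt_eqF // mulr1 subrKC.
by rewrite mulrCA divff ?gt_eqF // mulr1 subrKC.
Qed.

Lemma circ_dist x (r a b : R) : 0 <= r ->
  enorm (circ x r a - circ x r b) ^+ 2 = r ^+ 2 * (2 - 2 * cos (a - b)).
Proof.
move=> r0; rewrite sqr_enorm /circ /dot !coordE cosB.
have := cos2Dsin2 a; have := cos2Dsin2 b; rewrite !expr2 => ca cb.
transitivity (r * r * ((cos a * cos a + sin a * sin a)
   + (cos b * cos b + sin b * sin b) - 2 * (cos a * cos b + sin a * sin b))).
  by ring.
by rewrite ca cb; ring.
Qed.

Lemma continuous_circ x (r : R) : 0 <= r -> continuous (circ x r).
Proof.
move=> r0 a V /nbhs_enormP[e e0 eV].
have h0 : (fun b : R => r ^+ 2 * (2 - 2 * cos (b - a))) b @[b --> a]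
    --> r ^+ 2 * (2 - 2 * cos (a - a)).
  apply: cvgM; first exact: cvg_cst.
  apply: cvgB; first exact: cvg_cst.
  apply: cvgM; first exact: cvg_cst.
  apply: (continuous_comp (f := fun b => b - a)); last exact: continuous_cos.
  by apply: cvgB; [exact: cvg_id|exact: cvg_cst].
have e2 : 0 < e ^+ 2 by rewrite exprn_gt0.
move/cvgrPdist_lt: h0 => /(_ _ e2) h0.
apply: (@filterS R (nbhs a) _ _ _ _ h0) => b.
rewrite subrr cos0 mulr1 subrr mulr0 sub0r normrN => h.
apply: eV; rewrite -(@ltr_pXn2r _ 2) ?nnegrE ?enorm_ge0 ?(ltW e0) //.
by rewrite circ_dist //; apply: le_lt_trans h; exact: ler_norm.
Qed.

Definition circle x (r : R) : set (plane R) := [set z | enorm (z - x) = r].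

Lemma connected_circle x (r : R) : 0 <= r -> connected (circle x r).
Proof.
rewrite le_eqVlt => /predU1P[<-|r0].
  suff -> : circle x 0 = [set x] by exact: connected1.
  apply/seteqP; split => z; rewrite /circle /=.
    by move=> /enorm_eq0/subr0_eq.
  by move=> ->; rewrite subrr enorm0.
suff -> : circle x r = circ x r @` setT.
  apply: connected_continuous_connected.
    by apply/connected_intervalP.
  by apply: continuous_subspaceT; apply: continuous_circ; exact: ltW.
apply/seteqP; split => z /=.
  by move=> /(circ_surj r0)[a ->]; exists a.
by move=> [a _ <-]; apply: enorm_circ; exact: ltW.
Qed.

(** ** Continuous functions on the unit interval *)

(** The interval [0, 1] is connected by finite chains for any relation that
    relates each point to its neighbours.  This serves both to subdivide curves
    finely and to show that locally constant quantities are constant. *)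
Lemma chain01 (Q : R -> R -> Prop) :
  (forall t, 0 <= t <= 1 -> exists2 d, 0 < d &
     forall s, 0 <= s <= 1 -> `|s - t| < d -> Q s t /\ Q t s) ->
  exists n (f : nat -> R), [/\ f 0%N = 0, f n = 1,
    forall i, 0 <= f i <= 1 & forall i, (i < n)%N -> Q (f i) (f i.+1)].
Proof.
move=> HQ.
pose reach t := exists n (f : nat -> R), [/\ f 0%N = 0, f n = t,
    forall i, 0 <= f i <= 1 & forall i, (i < n)%N -> Q (f i) (f i.+1)].
have ext t s : reach t -> 0 <= s <= 1 -> Q t s -> reach s.
  move=> [n [f [f0 fn f01 fQ]]] s01 Qts.
  exists n.+1, (fun i => if (i <= n)%N then f i else s); split => //.
  - by rewrite ltnn.
  - by move=> i; case: ifP.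
  - move=> i; rewrite ltnS => lin; rewrite lin.
    by case: ltnP => [/fQ //|nin]; rewrite (_ : i = n) ?fn //; lia.
pose S : set R := [set t | 0 <= t <= 1 /\ reach t].
have S0 : S 0.
  split; first by rewrite lexx ler01.
  by exists 0%N, (fun=> 0); split => // i; rewrite lexx ler01.
have hS : has_sup S by split; [exists 0|exists 1 => t [/andP[_]]].
pose m := sup S.
have m01 : 0 <= m <= 1.
  apply/andP; split; first exact: (ub_le_sup hS.2 S0).
  by apply: ge_sup; [exists 0|move=> t [/andP[_]]].
have [d d0 dQ] := HQ m m01.
have [t [t01 rt] tm] := sup_adherent d0 hS; rewrite -/m in tm.
have tlem : t <= m by apply: (ub_le_sup hS.2); split.
have rm : reach m.
  by apply: (ext t) => //; apply: (dQ t t01 _).1; rewrite ltr_norml; lra.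
suff m1 : m = 1 by move: rm; rewrite m1.
apply/eqP; rewrite eq_le (andP m01).2 /= leNgt; apply/negP => m1.
have [t' [t'm t'd t'1]] : exists t', [/\ m < t', t' < m + d & t' <= 1].
  have [md|md] := leP (m + d / 2) 1.
    by exists (m + d / 2); split => //; lra.
  by exists 1; split => //; lra.
have t'01 : 0 <= t' <= 1 by rewrite t'1 andbT; move/andP: m01; lra.
suff : t' <= m by lra.
apply: (ub_le_sup hS.2); split => //; apply: (ext m) => //.
by apply: (dQ t' t'01 _).2; rewrite ltr_norml; lra.
Qed.

Definition econt (g : R -> plane R) := forall t, 0 <= t <= 1 ->
  forall e, 0 < e -> exists2 d, 0 < d &
    forall s, 0 <= s <= 1 -> `|s - t| < d -> enorm (g s - g t) < e.

Lemma within_econt (g : R -> plane R) :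
  {within `[0, 1]%classic, continuous g} <-> econt g.
Proof.
split=> [cg t t01 e e0|cg].
  have /subspace_continuousP/(_ t) := cg.
  have t01' : `[0, 1]%classic t by rewrite /= in_itv.
  move=> /(_ t01') h.
  have /h : nbhs (g t) [set y | enorm (y - g t) < e].
    by apply/nbhs_enormP; exists e.
  rewrite /= /within /= => /nbhs_ballP[d /= d0 dV].
  exists d => // s s01 st; apply: dV; last by rewrite in_itv.
  by rewrite -ball_normE /ball_ /= distrC.
apply/subspace_continuousP => t; rewrite /= in_itv /= => t01 V.
move=> /nbhs_enormP[e e0 eV]; have [d d0 dV] := cg t t01 e e0.
apply/nbhs_ballP; exists d => //= s; rewrite -ball_normE /ball_ /= distrC => st.
by rewrite in_itv /= => s01; apply: eV; exact: dV.
Qed.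

Lemma connected_path (g : R -> plane R) :
  econt g -> connected (g @` `[0, 1]%classic).
Proof.
move=> /within_econt cg; apply: connected_continuous_connected => //.
by apply/connected_intervalP; exact: interval_is_interval.
Qed.

Lemma within_comp_lip (g : R -> plane R) (f : plane R -> R) :
  continuous f -> econt g -> {within `[0, 1]%classic, continuous (f \o g)}.
Proof.
move=> cf /within_econt/subspace_continuousP cg.
by apply/subspace_continuousP => t t01 V /(cf (g t)) /(cg t t01).
Qed.

End Topology.

(** * Winding of a closed chain *)

Section Winding.
Variable R : realType.
Implicit Types (u v w x y z : plane R).

(** The oriented angle from [u] to [v], correct when it is acute. *)
Definition ang u v : R := atan (cross u v / dot u v).

Lemma atan_bounds (a : R) : - (pi / 2) < atan a < pi / 2.
Proof. by rewrite atan_gtNpi2 atan_ltpi2. Qed.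

Lemma cos_gt0_bound (a : R) : - pi < a < pi -> 0 < cos a ->
  - (pi / 2) < a < pi / 2.
Proof.
move=> api ca.
have nle (b : R) : 0 < cos b -> b < pi -> b < pi / 2.
  move=> cb bpi; rewrite ltNge; apply/negP => hb.
  have : 0 <= sin (b - pi / 2) by apply: sin_ge0_pi; have := pi_gt0 R; lra.
  by rewrite sinBpihalf; lra.
have h1 := nle a ca (andP api).2.
have h2 := nle (- a); rewrite cosN in h2; have := h2 ca; lra.
Qed.

(** In the frame of [e], the vectors [u] and [v] have polar angles [ang e u] and
    [ang e v] in the open right half plane, and the difference of these angles
    is acute because [dot u v] is positive. *)
Lemma ang_cocycle e u v : 0 < dot e u -> 0 < dot e v -> 0 < dot u v ->
  ang e v = ang e u + ang u v.
Proof.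
move=> eu ev uv.
set a := ang e u; set b := ang e v.
have ca : 0 < cos a by apply: cos_gt0_pihalf; exact: atan_bounds.
have cb : 0 < cos b by apply: cos_gt0_pihalf; exact: atan_bounds.
have ta : tan a = cross e u / dot e u by rewrite atanK.
have tb : tan b = cross e v / dot e v by rewrite atanK.
have e0 : 0 < dot e e.
  rewrite lt_neqAle dot_ge0 andbT; apply/eqP => e0; move: eu.
  have := dot_cross e u; rewrite -e0 mul0r => h; have := sqr_ge0 (cross e u); nra.
(* The components of u and v in the frame of e determine cross u v and dot u v
   up to the factor dot e e. *)
have h1 : cross e v * dot e u - cross e u * dot e v = dot e e * cross u v.
  by rewrite /cross /dot; ring.
have h2 : dot e u * dot e v + cross e u * cross e v = dot e e * dot u v.
  by rewrite /cross /dot; ring.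
have h3 : 1 + tan a * tan b = dot e e * dot u v / (dot e u * dot e v).
  by rewrite ta tb -h2; field; rewrite !gt_eqF.
have h4 : tan b - tan a = dot e e * cross u v / (dot e u * dot e v).
  by rewrite ta tb -h1; field; rewrite !gt_eqF.
have cba : 0 < cos (b - a).
  have -> : cos (b - a) = cos b * cos a * (1 + tan a * tan b).
    by rewrite cosB /tan; field; rewrite !gt_eqF.
  by rewrite h3; do ![apply: mulr_gt0 => // | rewrite invr_gt0].
have bound : - (pi / 2) < b - a < pi / 2.
  apply: cos_gt0_bound => //.
  by have := atan_bounds (cross e u / dot e u);
     have := atan_bounds (cross e v / dot e v); rewrite -!/(ang _ _) -/a -/b; lra.
suff -> : ang u v = b - a by lra.
rewrite -[RHS]tanK ?in_itv //; congr atan.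
rewrite tanD ?cosN ?gt_eqF // tanN mulrN opprK [tan b * _]mulrC h3 h4.
by field; rewrite !gt_eqF.
Qed.

Lemma dot_gt0_near e u : enorm (u - e) < enorm e -> 0 < dot e u.
Proof.
move=> ue; have := normr_dot_le e (u - e).
have -> : dot e (u - e) = dot e u - dot e e by rewrite /dot !coordE; ring.
rewrite -sqr_enorm; have := enorm_ge0 (u - e).
have := ler_norm (- (dot e u - enorm e ^+ 2)); rewrite normrN; nra.
Qed.

(** Moving the base point from [w] to [w'] changes the angle under which the
    segment from [p] to [q] is seen by a difference of end point contributions.
    Along a closed chain these telescope, which makes the total angle locally
    constant in the base point. *)
Lemma ang_square p q w w' (h : R) : enorm (q - p) < h -> enorm (w - w') < h ->
  2 * h <= enorm (p - w) -> 2 * h <= enorm (q - w) -> 2 * h <= enorm (p - w') ->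
  ang (p - w) (q - w) + ang (q - w) (q - w') =
  ang (p - w) (p - w') + ang (p - w') (q - w').
Proof.
move=> pq ww pw qw pw'.
have h0 : 0 < h by apply: le_lt_trans pq; exact: enorm_ge0.
have d1 a b c : 2 * h <= enorm (a - c) -> enorm (b - a) < h ->
    0 < dot (a - c) (b - c).
  by move=> hac hb; apply: dot_gt0_near; rewrite opprB addrA subrK; lra.
have d2 a b c : 2 * h <= enorm (a - b) -> enorm (b - c) < h ->
    0 < dot (a - b) (a - c).
  move=> hac hb; apply: dot_gt0_near.
  by rewrite (_ : a - c - (a - b) = b - c); [lra | rewrite opprB addrC addrA subrK].
have d3 : 0 < dot (p - w) (q - w').
  apply: dot_gt0_near.
  rewrite (_ : q - w' - (p - w) = (q - p) + (w - w')).
    by have := enormD (q - p) (w - w'); lra.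
  by rewrite opprB addrACA [- w' + _]addrC [in RHS]addrACA; congr (_ + _); rewrite addrC.
rewrite -!(@ang_cocycle (p - w)) //; first [exact: d1 | exact: d2].
Qed.

(** The total angle under which the closed curve is seen is constant along a path
    avoiding it.  It is positive from [b 0], around which the curve turns
    through the directions [D i], and zero from [b 1], seen from which the curve
    stays in one half plane. *)
Lemma cycle_meets_path (n : nat) (e D : nat -> plane R) (g : nat -> R -> plane R)
    (b : R -> plane R) (V : plane R) (h : R) :
  (0 < n)%N -> e n = e 0%N -> D n = D 0%N ->
  (forall i, (i < n)%N -> [/\ econt (g i), g i 0 = e i & g i 1 = e i.+1]) ->
  (forall i, (i < n)%N -> 0 < cross (D i) (D i.+1) /\ 0 < dot (D i) (D i.+1)) ->
  econt b -> 0 < h ->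
  (forall i (s t : R), (i < n)%N -> 0 <= s <= 1 -> 0 <= t <= 1 ->
     2 * h <= enorm (g i s - b t)) ->
  (forall i (s : R), (i < n)%N -> 0 <= s <= 1 -> 0 < dot (D i) (g i s - b 0)) ->
  (forall i (s : R), (i < n)%N -> 0 <= s <= 1 -> 0 < dot V (g i s - b 1)) ->
  False.
Proof.
move=> n0 en Dn gP DP cb h0 far Hin Hout.
have i01 : 0 <= (0 : R) <= 1 by rewrite lexx ler01.
have i11 : 0 <= (1 : R) <= 1 by rewrite lexx ler01.
have chain (i : nat) : exists mf : nat * (nat -> R), (i < n)%N ->
    [/\ mf.2 0%N = 0, mf.2 mf.1 = 1, forall j, 0 <= mf.2 j <= 1 &
     forall j, (j < mf.1)%N -> enorm (g i (mf.2 j.+1) - g i (mf.2 j)) < h].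
  case: (ltnP i n) => [lin|_]; last by exists (0%N, fun=> 0).
  have [ci _ _] := gP i lin.
  have [|m [f [f0 f1 f01 fQ]]] :=
      @chain01 R (fun s t => enorm (g i t - g i s) < h).
    move=> t t01; have [d d0 dd] := ci t t01 h h0; exists d => // s s01 st.
    by split; [rewrite enormBC|]; exact: dd.
  by exists (m, f).
have {chain} [mf mfP] := choice chain.
pose m i := (mf i).1; pose P i j := g i ((mf i).2 j).
have P0 i : (i < n)%N -> P i 0%N = e i.
  by move=> lin; rewrite /P; have [-> _ _ _] := mfP i lin; have [] := gP i lin.
have Pm i : (i < n)%N -> P i (m i) = e i.+1.
  by move=> lin; rewrite /P /m; have [_ -> _ _] := mfP i lin; have [] := gP i lin.
have Pstep i j : (i < n)%N -> (j < m i)%N -> enorm (P i j.+1 - P i j) < h.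
  by move=> lin ljm; have [_ _ _] := mfP i lin; apply.
have Pfar i j t : (i < n)%N -> 0 <= t <= 1 -> 2 * h <= enorm (P i j - b t).
  by move=> lin t01; apply: far => //; have [_ _ -> //] := mfP i lin.
(* The total angle turned by the chain, as seen from w. *)
pose W w := \sum_(0 <= i < n) \sum_(0 <= j < m i) ang (P i j - w) (P i j.+1 - w).
have stepW s t : 0 <= s <= 1 -> 0 <= t <= 1 -> enorm (b s - b t) < h ->
    W (b s) = W (b t).
  move=> s01 t01 st; apply/eqP; rewrite -subr_eq0 -sumrB; apply/eqP.
  pose c i := ang (e i - b s) (e i - b t).
  transitivity (\sum_(0 <= i < n) (- (c i.+1 - c i))); last first.
    by rewrite sumrN telescope_sumr // /c en subrr oppr0.
  apply: eq_big_nat => i /andP[_ lin]; rewrite -sumrB.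
  pose d j := ang (P i j - b s) (P i j - b t).
  have -> : - (c i.+1 - c i) = - (d (m i) - d 0%N) by rewrite /c /d P0 // Pm.
  rewrite -telescope_sumr // -sumrN; apply: eq_big_nat => j /andP[_ ljm].
  have := @ang_square (P i j) (P i j.+1) (b s) (b t) h (Pstep _ _ lin ljm) st
    (Pfar _ _ _ lin s01) (Pfar _ _ _ lin s01) (Pfar _ _ _ lin t01).
  rewrite /d; lra.
have piece i v t : (i < n)%N -> 0 <= t <= 1 ->
    (forall s, 0 <= s <= 1 -> 0 < dot v (g i s - b t)) ->
    \sum_(0 <= j < m i) ang (P i j - b t) (P i j.+1 - b t) =
    ang v (e i.+1 - b t) - ang v (e i - b t).
  move=> lin t01 vP; rewrite -(P0 i lin) -(Pm i lin).
  rewrite -(telescope_sumr (fun j => ang v (P i j - b t))) //.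
  have vPj j : 0 < dot v (P i j - b t).
    by apply: vP; have [_ _ -> //] := mfP i lin.
  apply: eq_big_nat => j /andP[_ ljm].
  rewrite (@ang_cocycle v (P i j - b t) (P i j.+1 - b t)) //; first by lra.
  apply: dot_gt0_near; rewrite opprB addrA subrK.
  by have := Pstep i j lin ljm; have := Pfar i j t lin t01; lra.
have Wb : W (b 1) = 0.
  rewrite /W; transitivity
    (\sum_(0 <= i < n) (ang V (e i.+1 - b 1) - ang V (e i - b 1))).
    by apply: eq_big_nat => i /andP[_ lin]; apply: piece => // s s01; exact: Hout.
  by rewrite (telescope_sumr (fun j => ang V (e j - b 1))) // en subrr.
have De i : (i < n)%N -> 0 < dot (D i) (e i - b 0).
  by move=> lin; have [_ <- _] := gP i lin; exact: Hin.
have Wa : W (b 0) = \sum_(0 <= i < n) ang (D i) (D i.+1).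
  rewrite /W; transitivity (\sum_(0 <= i < n)
    (ang (D i) (D i.+1) + (ang (D i.+1) (e i.+1 - b 0) - ang (D i) (e i - b 0)))).
    apply: eq_big_nat => i /andP[_ lin].
    rewrite (piece i (D i)) //; last by move=> s s01; exact: Hin.
    have DDi : 0 < dot (D i) (e i.+1 - b 0).
      by have [_ _ <-] := gP i lin; exact: Hin.
    have DSi : 0 < dot (D i.+1) (e i.+1 - b 0).
      move: lin; rewrite leq_eqVlt => /orP[/eqP ->|/De //].
      by rewrite Dn en; exact: De.
    by rewrite (ang_cocycle (DP i lin).2 DDi DSi) addrA.
  rewrite big_split /= (telescope_sumr (fun j => ang (D j) (e j - b 0))) //.
  by rewrite en Dn subrr addr0.
have Wpos : 0 < W (b 0).
  rewrite Wa.
  have pos i : (i < n)%N -> 0 < ang (D i) (D i.+1).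
    move=> lin; have [c0 d0] := DP i lin.
    by rewrite -atan0; apply: lt_atan; rewrite divr_gt0.
  rewrite big_mkord; case: n n0 pos {en Dn gP DP far Hin Hout mfP P0 Pm Pstep
     Pfar W stepW piece Wb De Wa} => // n _ pos.
  rewrite big_ord_recl; apply: ltr_pwDl; first exact: pos.
  by apply: sumr_ge0 => i _; apply: ltW; apply: pos; rewrite lift0 ltnS.
have [|k [f [f0 f1 f01 fQ]]] := @chain01 R (fun s t => W (b s) = W (b t)).
  move=> t t01; have [d d0 dd] := cb t t01 h h0; exists d => // s s01 st.
  by rewrite (stepW s t) //; exact: dd.
have : forall j, (j <= k)%N -> W (b (f j)) = W (b 0).
  elim=> [|j IH ljk]; first by rewrite f0.
  by rewrite -(fQ j) // IH // ltnW.
by move=> /(_ k (leqnn _)); rewrite f1 Wb => W0; move: Wpos; rewrite -W0 ltxx.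
Qed.

End Winding.

(** * Arc length and line integrals *)

(** The integral of a nonnegative function is a supremum over the simple
    functions below it, so monotonicity holds without measurability. *)
Lemma ge0_le_integral_nonmeasurable d (T : measurableType d) (R : realType)
    (mu : {measure set T -> \bar R}) (D : set T) (f1 f2 : T -> \bar R) :
  (forall x, D x -> (0 <= f1 x)%E) -> (forall x, D x -> (f1 x <= f2 x)%E) ->
  (\int[mu]_(x in D) f1 x <= \int[mu]_(x in D) f2 x)%E.
Proof.
move=> f10 f12.
rewrite !ge0_integralE //; last by move=> x Dx; exact: le_trans (f10 x Dx) (f12 x Dx).
apply: le_ereal_sup => _ [h /= hf <-]; exists h => // x.
by apply: le_trans (hf x) _; apply: lee_restrict.
Qed.

Section ArcLength.
Variable R : realType.
Implicit Types (g : R -> plane R) (s : seq R).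

Lemma polygonal_nil a b g : polygonal_length a b g [::] = 0.
Proof. by rewrite /polygonal_length big_geq. Qed.

Lemma polygonal_cons a b x g s : polygonal_length a b g (x :: s) =
  enorm (g x - g a) + polygonal_length x b g s.
Proof. by rewrite /polygonal_length /= big_nat_recl. Qed.

Lemma polygonal_rcons a b b' x g s : polygonal_length a b' g (rcons s x) =
  polygonal_length a b g s + enorm (g x - g (last a s)).
Proof.
elim: s a => [|y s IH] a /=; first by rewrite polygonal_cons !polygonal_nil addrC.
by rewrite !polygonal_cons IH addrA.
Qed.

Lemma polygonal_le_length a b g s : itv_partition a b s ->
  ((polygonal_length a b g s)%:E <= curve_length a b g)%E.
Proof. by move=> abs; apply: ereal_sup_ubound; exists s. Qed.

Lemma itv_partition_ex (a b : R) : a <= b -> exists s, itv_partition a b s.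
Proof.
rewrite le_eqVlt => /predU1P[->|ab]; first by exists [::].
by exists [:: b]; exact: itv_partition1.
Qed.

Lemma polygonal_ge0 a b g s : 0 <= polygonal_length a b g s.
Proof. by apply: sumr_ge0 => i _; exact: enorm_ge0. Qed.

Lemma curve_length_ge0 a b g : a <= b -> (0 <= curve_length a b g)%E.
Proof.
move=> /itv_partition_ex[s abs]; apply: le_trans (polygonal_le_length g abs).
by rewrite lee_fin polygonal_ge0.
Qed.

Lemma curve_length_xx a g : curve_length a a g = 0%E.
Proof.
apply/eqP; rewrite eq_le curve_length_ge0 // andbT.
by apply: ge_ereal_sup => _ [s /itv_partitionxx -> <-]; rewrite polygonal_nil.
Qed.

Lemma curve_length_right a b c g : a <= b -> b <= c ->
  (curve_length a b g + (enorm (g c - g b))%:E <= curve_length a c g)%E.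
Proof.
move=> ab; rewrite le_eqVlt => /predU1P[<-|bc].
  by rewrite subrr enorm0 adde0.
rewrite -leeBrDr //; apply: ge_ereal_sup => _ [s [abs lst] <-].
rewrite leeBrDr // -EFinD.
rewrite -{2}(eqP lst) -(polygonal_rcons _ _ c).
apply: polygonal_le_length; split; last by rewrite last_rcons.
by rewrite rcons_path abs (eqP lst).
Qed.

Lemma curve_length_left a b c g : a <= b -> b <= c ->
  ((enorm (g b - g a))%:E + curve_length b c g <= curve_length a c g)%E.
Proof.
rewrite le_eqVlt => /predU1P[<- _|ab bc].
  by rewrite subrr enorm0 add0e.
rewrite -leeBrDl //; apply: ge_ereal_sup => _ [s [abs lst] <-].
rewrite leeBrDl // -EFinD -polygonal_cons.
by apply: polygonal_le_length; split => //=; rewrite ab.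
Qed.

(** Splitting a partition at [b] does not shorten its polygon, and beyond [b] the
    bounds on the increments telescope. *)
Lemma curve_length_le_add a b c g (V : R -> R) : a <= b -> b <= c ->
  (forall x y, a <= x -> x <= y -> y <= c -> enorm (g y - g x) <= V y - V x) ->
  (curve_length a c g <= curve_length a b g + (V c - V b)%:E)%E.
Proof.
move=> ab bc gV; apply: ge_ereal_sup => _ [s acs <-].
have tele x t : a <= x -> itv_partition x c t -> polygonal_length x c g t <= V c - V x.
  elim: t x => [|y t IH] x ax; first by move=> /itv_partition_nil ->; rewrite polygonal_nil subrr.
  move=> xct; have yct := itv_partition_cons xct.
  have xy : x < y by case: xct => /= /andP[].
  have yc := itv_partition_le yct.
  rewrite polygonal_cons; have := IH y (le_trans ax (ltW xy)) yct.
  by have := gV x y ax (ltW xy) yc; lra.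
suff main : forall t x, a <= x -> x <= b -> itv_partition x c t ->
    ((polygonal_length x c g t)%:E <= curve_length x b g + (V c - V b)%:E)%E.
  exact: main.
move=> {s acs}; elim=> [|y t IH] x ax xb xct.
  rewrite polygonal_nil; apply: adde_ge0; first exact: curve_length_ge0.
  rewrite lee_fin; apply: le_trans (gV b c ab bc (lexx _)); exact: enorm_ge0.
have yct := itv_partition_cons xct.
have xy : x < y by case: xct => /= /andP[].
have yc := itv_partition_le yct.
rewrite polygonal_cons; have [yb|yb] := leP y b.
  have := IH y (le_trans ax (ltW xy)) yb yct => h.
  apply: (@le_trans _ _ ((enorm (g y - g x))%:E + curve_length y b g + (V c - V b)%:E)%E).
    by rewrite EFinD -addeA leeD2l.
  by rewrite leeD2r //; apply: curve_length_left => //; exact: ltW.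
apply: (@le_trans _ _ (curve_length x x g + (enorm (g b - g x))%:E + (V c - V b)%:E)%E).
  rewrite curve_length_xx add0e -EFinD lee_fin.
  have := tele y t (le_trans ax (ltW xy)) yct.
  have := gV b y ab (ltW yb) yc; have := enorm_tri (g b) (g y) (g x).
  rewrite (enormBC (g b) (g x)); lra.
by rewrite leeD2r //; apply: curve_length_right.
Qed.

(** A coordinate varies no more than the length of the curve; the variation
    functions of the coordinates then bound the length from above, and they are
    continuous. *)
Lemma coord_variation a b g s (i : 'I_2) :
  variation a b (fun t => g t 0 i) s <= polygonal_length a b g s.
Proof.
apply: ler_sum => k _; rewrite /= -coordB.
case: (unliftP ord0 i) => [j ->|->]; last exact: coord0_le.
by rewrite (ord1 j) (_ : lift _ _ = 1) ?coord1_le //; apply/val_inj.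
Qed.

Variable g : R -> plane R.
Hypothesis rg : rectifiable g.

Let coordv (i : 'I_2) (t : R) := g t 0 i.

Lemma coord_BV i : bounded_variation 0 1 (coordv i).
Proof.
have [_ lf] := rg; exists (fine (curve_length 0 1 g)) => _ [s s01 <-].
rewrite -lee_fin fineK; last first.
  by rewrite ge0_fin_numE // curve_length_ge0.
by apply: le_trans (polygonal_le_length g s01); rewrite lee_fin coord_variation.
Qed.

Lemma coord_within i : {within `[0, 1]%classic, continuous (coordv i)}.
Proof.
have [cg _] := rg; apply/subspace_continuousP => t t01 V.
move=> /(@coord_continuous _ _ _ 0 i (g t)).
by have /subspace_continuousP/(_ t t01) := cg; apply.
Qed.

Definition arc_bound (t : R) : R :=
  fine (total_variation 0 t (coordv 0)) + fine (total_variation 0 t (coordv 1)).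

Lemma arc_bound_within : {within `[0, 1]%classic, continuous arc_bound}.
Proof.
by apply: within_continuousD; apply: total_variation_continuous => //;
  [exact: coord_within|exact: coord_BV|exact: coord_within|exact: coord_BV].
Qed.

Lemma arc_boundP x y : 0 <= x -> x <= y -> y <= 1 ->
  enorm (g y - g x) <= arc_bound y - arc_bound x.
Proof.
move=> x0 xy y1.
have fin i t : 0 <= t <= 1 -> total_variation 0 t (coordv i) \is a fin_num.
  move=> /andP[t0 t1]; apply/(bounded_variationP _ t0).
  by apply: bounded_variationl (coord_BV i).
have H i : `|g y 0 i - g x 0 i| <=
    fine (total_variation 0 y (coordv i)) - fine (total_variation 0 x (coordv i)).
  rewrite lerBrDl -lee_fin EFinD !fineK; last 2 first.
  - by apply: fin; lra.
  - by apply: fin; lra.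
  by rewrite (total_variationD (coordv i) x0 xy) leeD2l // total_variation_ge.
apply: le_trans (enorm_le_sum _) _; rewrite !coordB /arc_bound.
by have := H 0; have := H 1; lra.
Qed.

Definition arclen (t : R) : R := fine (curve_length 0 t g).

Lemma arclenE t : 0 <= t <= 1 -> curve_length 0 t g = (arclen t)%:E.
Proof.
move=> /andP[t0 t1]; rewrite /arclen fineK // ge0_fin_numE ?curve_length_ge0 //.
apply: le_lt_trans rg.2; apply: le_trans (curve_length_right g t0 t1).
by rewrite leeDl // lee_fin enorm_ge0.
Qed.

Lemma arclen_ge x y : 0 <= x -> x <= y -> y <= 1 ->
  enorm (g y - g x) <= arclen y - arclen x.
Proof.
move=> x0 xy y1; rewrite lerBrDl -lee_fin EFinD -!arclenE; last 2 first.
- by lra.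
- by lra.
exact: curve_length_right.
Qed.

Lemma arclen_le x y : 0 <= x -> x <= y -> y <= 1 ->
  arclen y - arclen x <= arc_bound y - arc_bound x.
Proof.
move=> x0 xy y1; rewrite lerBlDl -lee_fin EFinD -!arclenE; last 2 first.
- by lra.
- by lra.
apply: curve_length_le_add => // u v u0 uv vy; apply: arc_boundP => //.
exact: le_trans y1.
Qed.

Lemma arclen_within : {within `[0, 1]%classic, continuous arclen}.
Proof.
apply/subspace_continuousP => t t01 V /nbhs_ballP[e /= e0 eV].
have /subspace_continuousP/(_ t t01 (ball (arc_bound t) e)) := arc_bound_within.
move=> /(_ (nbhsx_ballx _ _ e0)); rewrite /= /within /= => /nbhs_ballP[d /= d0 dP].
apply/nbhs_ballP; exists d => //= s /dP h s01; apply: eV; move: (h s01) (t01) (s01) => {h t01 s01}.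
rewrite -!ball_normE /ball_ /from_subspace /= !in_itv /= => h t01 s01.
apply: le_lt_trans h; have [st|/ltW ts] := leP s t.
  have h1 := arclen_le (andP s01).1 st (andP t01).2.
  have h2 := arclen_ge (andP s01).1 st (andP t01).2.
  have h3 := enorm_ge0 (g t - g s).
  by rewrite !ger0_norm //; lra.
have h1 := arclen_le (andP t01).1 ts (andP s01).2.
have h2 := arclen_ge (andP t01).1 ts (andP s01).2.
have h3 := enorm_ge0 (g s - g t).
by rewrite distrC (distrC (arc_bound t)) !ger0_norm //; lra.
Qed.

(** Times with the same arc length give the same point of the curve, so it does
    not matter that [arc_param] chooses the least of them. *)
Lemma arc_paramK t : 0 <= t <= 1 -> arc_param g (arclen t) = g t.
Proof.
move=> t01; rewrite /arc_param; set S := [set _ | _].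
have SP (s : R) : S s -> 0 <= s <= 1 /\ g s = g t.
  move=> [s01]; rewrite arclenE // => -[st]; split => //.
  apply/subr0_eq/enorm_eq0/eqP; rewrite eq_le enorm_ge0 andbT.
  have [le_st|/ltW le_ts] := leP s t.
    by have := arclen_ge (andP s01).1 le_st (andP t01).2; rewrite st subrr enormBC.
  by have := arclen_ge (andP t01).1 le_ts (andP s01).2; rewrite st subrr.
have St : S t by split => //; exact: arclenE.
have hS : has_inf S.
  by split; [exists t|exists 0 => s /SP[/andP[]]].
set m := inf S.
have m01 : 0 <= m <= 1.
  apply/andP; split; first by apply: lb_le_inf; [exists t|move=> s /SP[/andP[]]].
  by apply: le_trans (andP t01).2; apply: ge_inf => //; exact: hS.2.
apply/subr0_eq/enorm_eq0/eqP; rewrite eq_le enorm_ge0 andbT.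
apply/ler_addgt0Pl => e e0; rewrite addr0.
have [d d0 dd] := (within_econt _).1 rg.1 m m01 e e0.
have [s Ss sm] := inf_adherent d0 hS; have [s01 <-] := SP s Ss.
rewrite enormBC ltW //; apply: dd => //.
by have := ge_inf hS.2 Ss; rewrite -/m => ms; rewrite ltr_norml; move: sm; rewrite -/m; lra.
Qed.

(** The intervals of arc length travelled between the times [sg k] and [tau k]
    are disjoint, since the pieces of the curve are, and each of them is at
    least as long as the distance between its end points. *)
Lemma line_integral_ge (f : plane R -> \bar R) (r : seq nat) (sg tau : nat -> R)
    (c w : R) :
  uniq r -> 0 <= c -> (forall z, (0 <= f z)%E) ->
  (forall k : nat, k \in r -> [/\ 0 <= sg k, sg k <= tau k & tau k <= 1]) ->
  (forall k : nat, k \in r -> w <= enorm (g (tau k) - g (sg k))) ->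
  (forall (k : nat) t, k \in r -> sg k <= t <= tau k -> (c%:E <= f (g t))%E) ->
  (forall (k k' : nat) t t', k \in r -> k' \in r -> sg k <= t <= tau k ->
     sg k' <= t' <= tau k' -> g t = g t' -> k = k') ->
  ((c * w * (size r)%:R)%:E <= line_integral g f)%E.
Proof.
move=> ur c0 f0 stP wP fP disj.
pose J k : set R := `[arclen (sg k), arclen (tau k)]%classic.
pose h (l : R) : \bar R := (\sum_(k <- r) (c%:E * (\1_(J k) l)%:E))%E.
have mJ k : measurable (J k) by exact: measurable_itv.
have JP k l : k \in r -> J k l -> exists2 t, sg k <= t <= tau k & arclen t = l.
  move=> kr; rewrite /J /= in_itv /= => lJ; have [s0 st t1] := stP k kr.
  have cs : {within `[sg k, tau k]%classic, continuous arclen}.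
    apply: continuous_subspaceW arclen_within => u /=.
    by rewrite !in_itv /= => /andP[su ut]; rewrite (le_trans s0) // (le_trans ut).
  have [|t tin tl] := @IVT R arclen (sg k) (tau k) l st cs.
    by have := andP lJ => -[h1 h2]; rewrite ge_min le_max h1 h2 orbT.
  by exists t => //; move: tin; rewrite in_itv.
have JD k : k \in r -> J k `<=` `[0, arclen 1]%classic.
  move=> kr l /(JP k l kr)[t tin <-]; have [s0 st t1] := stP k kr.
  have t01 : 0 <= t <= 1 by move/andP: tin; lra.
  rewrite /= in_itv /=; apply/andP; split.
    by rewrite /arclen fine_ge0 // curve_length_ge0 //; case/andP: t01.
  have := arclen_ge (andP t01).1 (andP t01).2 (lexx _).
  by have := enorm_ge0 (g 1 - g t); lra.
apply: (@le_trans _ _ (\int[lebesgue_measure]_(l in `[0%R, arclen 1]) h l)%E).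
  rewrite ge0_integral_sum //; last first.
  - by move=> k l _; rewrite mule_ge0 // lee_fin.
  - move=> k; apply: measurable_funeM; apply/measurable_EFinP.
    exact: measurable_indic (mJ k).
  rewrite (eq_big_seq (fun k => (c * (arclen (tau k) - arclen (sg k)))%:E)); last first.
    move=> k kr; rewrite ge0_integralZl_EFin //; last first.
      by apply/measurable_EFinP; exact: measurable_indic (mJ k).
    rewrite integral_indic; first last; [exact: mJ|by []|rewrite setIidl; last exact: JD].
    rewrite /J /= lebesgue_measure_itv /= lte_fin EFinM; congr (_ * _)%E.
    case: ltP => // h0; congr EFin.
    have [s0 st t1] := stP k kr; have := arclen_ge s0 st t1.
    by have := enorm_ge0 (g (tau k) - g (sg k)); lra.
  rewrite sumEFin lee_fin.
  apply: (@le_trans _ _ (\sum_(k <- r) (c * w))).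
    by rewrite big_const_seq count_predT iter_addr_0 mulr_natr.
  rewrite big_seq [leRHS]big_seq; apply: ler_sum => k kr.
  have [s0 st t1] := stP k kr; rewrite ler_wpM2l //.
  by apply: le_trans (wP k kr) _; exact: arclen_ge.
apply: ge0_le_integral_nonmeasurable => l lL.
  by rewrite /h; apply: sume_ge0 => k _; rewrite mule_ge0 // lee_fin.
have [[k kr Jkl]|nJ] := pselect (exists2 k, k \in r & J k l); last first.
  rewrite /h big_seq big1 // => k kr; rewrite indicE memNset ?mule0 // => Jkl.
  by apply: nJ; exists k.
have [t tin tl] := JP k l kr Jkl.
have [s0 st t1] := stP k kr.
have t01 : 0 <= t <= 1 by move/andP: tin; lra.
rewrite -tl arc_paramK //; apply: le_trans (fP k t kr tin).
rewrite /h (bigD1_seq k) //= indicE mem_set ?mule1; last by rewrite tl.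
rewrite big_seq_cond big1 ?adde0 // => k' /andP[k'r k'k].
rewrite indicE memNset ?mule0 // tl => /(JP k' l k'r)[t' t'in t'l].
move/eqP: k'k; apply; apply: (disj k' k t' t) => //.
have [s0' st' t1'] := stP k' k'r.
have t'01 : 0 <= t' <= 1 by move/andP: t'in; lra.
by rewrite -(arc_paramK t01) -(arc_paramK t'01) tl t'l.
Qed.

End ArcLength.

(** * Crossing an annulus *)

Section Crossing.
Variable R : realType.

Definition rcont (u : R -> R) (a b : R) := forall t, a <= t <= b ->
  forall e, 0 < e -> exists2 d, 0 < d &
    forall s, a <= s <= b -> `|s - t| < d -> `|u s - u t| < e.

Lemma last_exit (u : R -> R) (a b lo : R) : a <= b -> rcont u a b ->
  u a <= lo -> lo <= u b ->
  exists s, [/\ a <= s <= b, u s = lo & forall v, s < v <= b -> lo < u v].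
Proof.
move=> ab cu ua ub.
pose S : set R := [set v | a <= v <= b /\ u v <= lo].
have Sa : S a by split => //; rewrite lexx.
have hS : has_sup S by split; [exists a|exists b => v [/andP[]]].
have Sle v : S v -> v <= sup S by move=> Sv; exact: (ub_le_sup hS.2 Sv).
set s := sup S in Sle *.
have sab : a <= s <= b.
  by rewrite Sle //=; apply: ge_sup; [exists a|move=> v [/andP[]]].
exists s; split => //; last first.
  move=> v /andP[sv vb]; rewrite ltNge; apply/negP => uv.
  have : S v by split => //; move/andP: sab; lra.
  by move=> /Sle; lra.
apply/eqP; rewrite eq_le; apply/andP; split; rewrite leNgt; apply/negP => us.
  have e0 : 0 < u s - lo by lra.
  have [d d0 dP] := cu s sab _ e0.
  have [v Sv sv] := sup_adherent d0 hS; rewrite -/s in sv.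
  have vs := Sle v Sv; have [vab uv] := Sv.
  have := dP v vab; rewrite !ltr_norml => h.
  by have := h ltac:(lra); lra.
have e0 : 0 < lo - u s by lra.
have [d d0 dP] := cu s sab _ e0.
have sb : s < b.
  by rewrite lt_neqAle (andP sab).2 andbT; apply/eqP => sb; move: ub; rewrite -sb; lra.
have [v [sv vd vb]] : exists v, [/\ s < v, v < s + d & v <= b].
  have [md|md] := leP (s + d / 2) b; first by exists (s + d / 2); split => //; lra.
  by exists b; split => //; lra.
have vab : a <= v <= b by move/andP: sab; lra.
have := dP v vab; rewrite !ltr_norml => h; have {}h := h ltac:(lra).
have /Sle : S v by split => //; move/andP: h; lra.
lra.
Qed.

Lemma first_entry (u : R -> R) (a b hi : R) : a <= b -> rcont u a b ->
  u a <= hi -> hi <= u b ->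
  exists s, [/\ a <= s <= b, u s = hi & forall v, a <= v < s -> u v < hi].
Proof.
move=> ab cu ua ub.
have [||||s [sab us sP]] := @last_exit (fun v => - u (- v)) (- b) (- a) (- hi).
- lra.
- move=> t tab e e0; have [|d d0 dP] := cu (- t) _ e e0;
    first by move/andP: tab => [? ?]; apply/andP; split; lra.
  exists d => // s sab st; rewrite -opprD normrN; apply: dP; first by lra.
  by rewrite -opprD normrN.
- by rewrite opprK; lra.
- by rewrite opprK; lra.
exists (- s); split; [lra|lra|move=> v vP].
by have := sP (- v); rewrite opprK => h; have := h ltac:(lra); lra.
Qed.

(** A curve going from inside radius [lo] to outside radius [hi] has a piece
    that goes from one circle to the other and stays between them: start at the
    last exit from the small disk, stop at the next arrival at the large
    circle. *)
Lemma band_crossing (g : R -> plane R) (e : plane R) (lo hi s : R) : econt g ->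
  0 <= s <= 1 -> enorm (g 0 - e) <= lo -> lo < hi -> hi <= enorm (g s - e) ->
  exists a b, [/\ 0 <= a, a <= b & b <= 1] /\
    [/\ enorm (g a - e) = lo, enorm (g b - e) = hi &
        forall v, a <= v <= b -> lo <= enorm (g v - e) <= hi].
Proof.
move=> cg s01 g0 lohi gs; pose u v := enorm (g v - e).
have cu a b : 0 <= a -> b <= 1 -> rcont u a b.
  move=> a0 b1 t tab eps eps0; have [|d d0 dP] := cg t _ eps eps0.
    by move/andP: tab; lra.
  exists d => // v vab vt; have h : enorm (g v - g t) < eps.
    by apply: dP => //; move/andP: vab; lra.
  rewrite /u ltr_norml.
  have := enorm_tri (g t) (g v) e; have := enorm_tri (g v) (g t) e.
  by rewrite (enormBC (g t) (g v)); lra.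
have [s0 s1] := andP s01.
have [|a [aP ua aQ]] := @last_exit u 0 s lo s0 (cu 0 s (lexx _) s1) g0; first by rewrite /u; lra.
have [a0 as_] := andP aP.
have [|b [bP ub bQ]] := @first_entry u a s hi as_ (cu a s a0 s1) _ gs; first by rewrite ua ltW.
exists a, b; split; first by split; lra.
split => // v /andP[av vb]; apply/andP; split.
  have [<-|nav] := eqVneq a v; first by rewrite -/(u a) ua.
  by rewrite ltW //; apply: aQ; rewrite lt_neqAle nav av; lra.
have [->|nvb] := eqVneq v b; first by rewrite -/(u b) ub.
by rewrite ltW //; apply: bQ; rewrite av lt_neqAle nvb.
Qed.

End Crossing.

(** * Many points at a given distance from the boundary *)

Section LocalGeometry.
Variables (R : realType) (Omega : set (plane R)).
Implicit Types (x z e : plane R).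
Local Notation E := (boundary Omega).

Definition boundary_meets_circles (r0 : R) := forall x r, E x -> 0 < r -> r <= r0 ->
  exists2 c, E c & enorm (c - x) = r.

(** On scales up to [r0], the domain looks unbounded from every point. *)
Definition exits_disks (r0 : R) := forall x, exists2 b, Omega b & 2 * r0 <= enorm (b - x).

Lemma boundary_out z : open Omega -> E z -> ~ Omega z.
Proof. by move=> oO [_ nI] Oz; apply: nI; rewrite (interior_id Omega).1. Qed.

Lemma far_point (B r : R) x : (forall z, Omega z -> `|z| <= B) -> 0 <= r ->
  exists2 z, ~ Omega z & r <= enorm (z - x).
Proof.
move=> OB r0; pose K := `|B| + 1 + `|x 0 0| + r.
exists (mkpt K 0).
  move=> /OB; apply/negP; rewrite -ltNge.
  apply: lt_le_trans (coord_le_norm (mkpt K 0) 0); rewrite mkpt0.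
  have := ler_norm K; have := ler_norm B; have := normr_ge0 (x 0 0).
  by rewrite /K; lra.
apply: le_trans (coord0_le _); rewrite !coordE.
have := ler_norm (K - x 0 0); have := ler_norm (x 0 0); have := normr_ge0 B.
by rewrite /K; lra.
Qed.

Lemma boundary_neq0 (B : R) : Omega !=set0 -> (forall z, Omega z -> `|z| <= B) ->
  E !=set0.
Proof.
move=> [a Oa] OB; have [b nOb _] := far_point a OB (lexx 0).
pose g (t : R) : plane R := a + t *: (b - a).
have cg : econt g.
  move=> t t01 eps eps0; pose K := enorm (b - a) + 1.
  have K0 : 0 < K by rewrite /K; have := enorm_ge0 (b - a); lra.
  exists (eps / K); first by rewrite divr_gt0.
  move=> s s01; rewrite ltr_pdivlMr // => st.
  rewrite /g opprD addrACA subrr add0r -scalerBl.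
  have -> : enorm ((s - t) *: (b - a)) = `|s - t| * enorm (b - a).
    rewrite !enormE /dot !coordE -(sqrtr_sqr (s - t)) -sqrtrM ?sqr_ge0 //.
    by congr Num.sqrt; ring.
  by move: st; rewrite /K; have := normr_ge0 (s - t); nra.
have ga : (g @` `[0, 1]%classic) a.
  by exists 0; [rewrite /= in_itv /= lexx ler01|rewrite /g scale0r addr0].
have gb : (g @` `[0, 1]%classic) b.
  by exists 1; [rewrite /= in_itv /= lexx ler01|rewrite /g scale1r addrC subrK].
have [c _ Ec] := connected_boundary (connected_path cg) ga gb Oa nOb.
by exists c.
Qed.

Lemma exits_disks_ex : Omega !=set0 -> open Omega -> exists2 r0, 0 < r0 & exits_disks r0.
Proof.
move=> [a Oa] oO; have /nbhs_enormP[eps eps0 epsO] : nbhs a Omega.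
  by apply: open_nbhs_nbhs.
pose a' := a + mkpt (eps / 2) 0.
have aa : enorm (a' - a) = eps / 2.
  rewrite /a' addrAC subrr add0r enormE /dot !coordE mulr0 addr0 -expr2 sqrtr_sqr.
  by rewrite ger0_norm //; lra.
have Oa' : Omega a' by apply: epsO; rewrite aa; lra.
exists (eps / 8); first by lra.
move=> x; have [h|h] := leP (2 * (eps / 8)) (enorm (a - x)); first by exists a.
exists a' => //; have := enorm_tri x a' a; rewrite (enormBC x a); lra.
Qed.

(** A small circle about a boundary point meets [Omega], which is connected and
    has points inside and outside, and it meets the complement, in which the
    centre is joined to a far point by a curve. *)
Lemma boundary_meets_circles_ex (p C B r0 : R) : domain Omega ->
  (forall z, Omega z -> `|z| <= B) -> curve_condition p C Omega -> exits_disks r0 ->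
  boundary_meets_circles r0.
Proof.
case=> O0 cO oO OB cc lv x r Ex rpos rr0.
have nOx := boundary_out oO Ex.
have [[a Oa ax] [b Ob bx]] :
    (exists2 a, Omega a & enorm (a - x) < r) /\ (exists2 b, Omega b & r <= enorm (b - x)).
  split; first by have [/closure_enormP/(_ r rpos)] := Ex.
  by have [b Ob bx] := lv x; exists b => //; lra.
have [w Ow wr] := connected_ivt cO (@enormB_continuous R x) Oa Ob (ltW ax) bx.
have [z nOz zr] := far_point x OB (ltW rpos).
have [g [[/within_econt cg _] gO g0 g1 _]] := cc x z nOx nOz.
have [| | | |w' [t t01 gt] w'r] := @connected_ivt R (g @` `[0, 1]%classic)
    (fun z => enorm (z - x)) x z r (connected_path cg) (@enormB_continuous R x).
- by exists 0; rewrite //= in_itv /= lexx ler01.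
- by exists 1; rewrite //= in_itv /= lexx ler01.
- by rewrite subrr enorm0 ltW.
- by [].
have nOw' : ~ Omega w'.
  by rewrite -gt; apply: gO; move: t01; rewrite /= in_itv.
have [c cr Ec] := connected_boundary (@connected_circle R x r (ltW rpos)) (wr : circle x r w)
   (w'r : circle x r w') Ow nOw'.
by exists c.
Qed.

Hypothesis E0 : E !=set0.

(** The distance to the boundary vanishes somewhere on the circle through [z],
    so it takes all values between 0 and its value at [z]. *)
Lemma level_on_circle (r0 t : R) e z : boundary_meets_circles r0 -> E e -> 0 < t ->
  0 < enorm (z - e) -> enorm (z - e) <= r0 -> t <= dist_to z E ->
  exists2 q, enorm (q - e) = enorm (z - e) & dist_to q E = 3 / 4 * t.
Proof.
move=> cm Ee t0 ze zr0 dz; have [c Ec ce] := cm e _ Ee ze zr0.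
have [||q qe qd] := @connected_ivt R (circle e (enorm (z - e)))
  (fun w => dist_to w E) c z (3 / 4 * t)
  (@connected_circle R e _ (ltW ze)) (dist_continuous E0) ce (erefl _).
- by rewrite dist_self //; lra.
- by lra.
by exists q.
Qed.

Lemma radial_separation x q q' (a b : R) : enorm (q - x) = a ->
  enorm (q' - x) = b -> `|a - b| <= enorm (q - q').
Proof.
move=> <- <-; rewrite ler_norml.
have := enorm_tri q' q x; have := enorm_tri q q' x; rewrite (enormBC q' q); lra.
Qed.

End LocalGeometry.

Section LevelPoints.
Variables (R : realType) (Omega : set (plane R)) (p r0 : R) (N : nat) (t : R).
Implicit Types (x z e : plane R).
Local Notation E := (boundary Omega).

Hypotheses (E0 : E !=set0) (p1 : 1 < p) (p2 : p < 2) (N0 : (0 < N)%N) (t0 : 0 < t).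
Hypothesis cm : boundary_meets_circles Omega r0.

Lemma dist_weight_ge0 z : (0 <= dist_weight Omega p z)%E.
Proof. by rewrite /dist_weight; case: ifP => // _; rewrite lee_fin powR_ge0. Qed.

(** The exponent [1 - p] is negative, so the weight decreases with the
    distance. *)
Lemma dist_weight_near z : dist_to z E < t ->
  ((t `^ (1 - p))%:E <= dist_weight Omega p z)%E.
Proof.
move=> dz; rewrite /dist_weight; case: ifPn => [_|]; first by rewrite leey.
rewrite notin_setE => nE; rewrite lee_fin.
have d0 := dist_gt0 (@closed_boundary _ Omega) E0 nE.
rewrite -(opprB p 1) !powRN lef_pV2 ?posrE ?powR_gt0 //.
by apply: ge0_ler_powR (ltW dz); rewrite ?nnegrE ?subr_ge0; exact: ltW.
Qed.

Lemma powR_3t : (3 * t) `^ (2 - p) <= 3 * t * t `^ (1 - p).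
Proof.
rewrite powRM ?(ltW t0) //.
have ht : t `^ (2 - p) = t * t `^ (1 - p).
  rewrite (_ : 2 - p = 1 + (1 - p)); last by ring.
  by rewrite powRD ?(gt_eqF t0) ?implybT // powRr1 // ltW.
have h3 : (3 : R) `^ (2 - p) <= 3.
  apply: ler1_powR; first by rewrite ler1n.
  by rewrite lerBlDr -lerBlDl; apply: le_trans (ltW p1); rewrite lerBlDr -natr1 addrC.
rewrite ht mulrA; apply: ler_wpM2r; first exact: powR_ge0.
by apply: ler_wpM2r => //; exact: ltW.
Qed.

Definition level_points x (rad : R) := exists q : nat -> plane R,
  (forall k, (k < N)%N -> enorm (q k - x) <= rad /\ dist_to (q k) E = 3 / 4 * t) /\
  (forall k k', (k < N)%N -> (k' < N)%N -> k != k' -> 2 * t <= enorm (q k - q k')).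

(** Among [3 * N] disjoint annuli of width [2 * t] about [e], all crossed by the
    curve, the bound on the line integral leaves at most [3 * N / 2] in which
    the curve keeps closer than [t] to the boundary. *)
Lemma level_points_of_escape e (g : R -> plane R) (s : R) :
  E e -> 16 * N%:R * t <= r0 -> rectifiable g -> g 0 = e -> 0 <= s <= 1 ->
  16 * N%:R * t <= enorm (g s - e) ->
  (line_integral g (dist_weight Omega p) <= (N%:R * (3 * t) `^ (2 - p))%:E)%E ->
  level_points e (16 * N%:R * t).
Proof.
move=> Ee rr0 rg g0 s01 gs Ig; have tp := t0.
have N1 : 1 <= N%:R :> R by rewrite ler1n.
have /within_econt cg := rg.1.
pose lo k : R := 4 * t * k.+1%:R; pose hi k : R := lo k + 2 * t.
have lo0 k : 0 < lo k by rewrite /lo !mulr_gt0.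
have hi_le k : (k < 3 * N)%N -> hi k <= 16 * N%:R * t.
  move=> k3; have : k.+1%:R <= 3 * N%:R :> R by rewrite -natrM ler_nat.
  by rewrite /hi /lo; nra.
have hi_lo k k' : (k < k')%N -> hi k + 2 * t <= lo k'.
  move=> kk'; have : k.+2%:R <= k'.+1%:R :> R by rewrite ler_nat.
  by rewrite /hi /lo -[k.+2]addn1 natrD; nra.
(* The annuli in which the curve gets at distance t from the boundary. *)
pose good k := `[< exists v : R, [/\ 0 <= v <= 1, lo k <= enorm (g v - e) <= hi k &
  t <= dist_to (g v) E] >].
pose G := [seq k <- iota 0 (3 * N) | good k].
pose r := [seq k <- iota 0 (3 * N) | ~~ good k].
have Gr : (size G + size r = 3 * N)%N.
  by rewrite !size_filter count_predC size_iota.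
have rP k : k \in r -> ~~ good k /\ (k < 3 * N)%N.
  by rewrite mem_filter mem_iota add0n leq0n => /andP[].
have GP k : k \in G -> good k /\ (k < 3 * N)%N.
  by rewrite mem_filter mem_iota add0n leq0n => /andP[].
have cross k : exists ab : R * R, k \in r ->
    [/\ 0 <= ab.1, ab.1 <= ab.2 & ab.2 <= 1] /\
    [/\ enorm (g ab.1 - e) = lo k, enorm (g ab.2 - e) = hi k &
        forall v, ab.1 <= v <= ab.2 -> lo k <= enorm (g v - e) <= hi k].
  have [kr|kr] := boolP (k \in r); last by exists (0, 0).
  have [|||a [b [h1 h2]]] := @band_crossing R g e (lo k) (hi k) s cg s01.
  - by rewrite g0 subrr enorm0 ltW.
  - by rewrite /hi; lra.
  - by apply: le_trans gs; apply: hi_le; have [] := rP k kr.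
  by exists (a, b).
have {cross} [ab abP] := choice cross.
have size_r : (2 * size r <= 3 * N)%N.
  have := @line_integral_ge R g rg (dist_weight Omega p) r (fun k => (ab k).1)
    (fun k => (ab k).2) (t `^ (1 - p)) (2 * t).
  move=> /(_ (filter_uniq _ (iota_uniq _ _)) (powR_ge0 _ _) dist_weight_ge0).
  have h1 k : k \in r -> [/\ 0 <= (ab k).1, (ab k).1 <= (ab k).2 & (ab k).2 <= 1].
    by move=> /abP[].
  have h2 k : k \in r -> 2 * t <= enorm (g (ab k).2 - g (ab k).1).
    move=> /abP[_ [ha hb _]]; apply: le_trans (radial_separation hb ha).
    by apply: le_trans (ler_norm _); rewrite /hi; lra.
  have h3 k v : k \in r -> (ab k).1 <= v <= (ab k).2 ->
      ((t `^ (1 - p))%:E <= dist_weight Omega p (g v))%E.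
    move=> kr vab; have [[a0 _ b1] [_ _ hv]] := abP k kr.
    apply: dist_weight_near; rewrite ltNge; apply/negP => dv.
    have [/negP bad _] := rP k kr; apply: bad; apply/asboolP; exists v.
    by split => //; [lra|exact: hv].
  have h4 (k k' : nat) v v' : k \in r -> k' \in r -> (ab k).1 <= v <= (ab k).2 ->
      (ab k').1 <= v' <= (ab k').2 -> g v = g v' -> k = k'.
    move=> kr k'r vab v'ab gvv'.
    have [_ [_ _ /(_ v vab) h]] := abP k kr.
    have [_ [_ _ /(_ v' v'ab) h']] := abP k' k'r.
    move: h'; rewrite -gvv' => h'.
    have [//|] := eqVneq k k'; rewrite neq_ltn => /orP[] /hi_lo hl; exfalso; lra.
  move=> /(_ h1 h2 h3 h4) lb; have := le_trans lb Ig; rewrite lee_fin.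
  have := powR_3t; set P := t `^ (1 - p); have P0 : 0 < P by rewrite powR_gt0.
  move=> h3t hh; rewrite -(ler_nat R) !natrM.
  have : P * (2 * t) * (size r)%:R <= N%:R * (3 * t * P) by nra.
  rewrite (_ : P * (2 * t) * (size r)%:R = (P * t) * (2 * (size r)%:R)); last by ring.
  rewrite (_ : N%:R * (3 * t * P) = (P * t) * (3 * N%:R)); last by ring.
  by rewrite ler_pM2l // mulr_gt0.
have size_G : (N <= size G)%N by lia.
have level k : exists q, k \in G ->
    [/\ lo k <= enorm (q - e) <= hi k & dist_to q E = 3 / 4 * t].
  have [kG|kG] := boolP (k \in G); last by exists 0.
  have [/asboolP[v [v01 gv dv]] k3] := GP k kG.
  have [|||q qe qd] := @level_on_circle R Omega E0 r0 t e (g v) cm Ee t0.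
  - by have := lo0 k; lra.
  - by have := hi_le k k3; lra.
  - by [].
  by exists q => _; rewrite qe.
have {level} [q qP] := choice level.
have nG k : (k < N)%N -> nth 0%N G k \in G.
  by move=> kN; apply: mem_nth; exact: leq_trans kN _.
exists (fun k => q (nth 0%N G k)); split.
  move=> k /nG kG; have [qe qd] := qP _ kG; split => //.
  by have [_ /hi_le] := GP _ kG; lra.
have sep k k' : k \in G -> k' \in G -> (k < k')%N -> 2 * t <= enorm (q k - q k').
  move=> kG k'G kk'; apply: le_trans (radial_separation (erefl _) (erefl _)).
  rewrite distrC; apply: le_trans (ler_norm _).
  have [h _] := qP _ kG; have [h' _] := qP _ k'G.
  by have := hi_lo _ _ kk'; lra.
move=> k k' kN k'N kk'.
have : nth 0%N G k != nth 0%N G k'.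
  rewrite nth_uniq //; [exact: leq_trans kN _|exact: leq_trans k'N _|].
  by rewrite filter_uniq // iota_uniq.
rewrite neq_ltn => /orP[|] lt; first by apply: sep => //; exact: nG.
by rewrite enormBC; apply: sep => //; exact: nG.
Qed.

End LevelPoints.

(** The regular [n]-gon inscribed in a circle of radius [s0] has sides at most
    [t] for large [n]; the sine and cosine are those of its angle at the
    centre. *)
Lemma fine_polygon (R : realType) (s0 t : R) : 0 < s0 -> 0 < t ->
  exists n : nat, [/\ (0 < n)%N, 0 < sin (pi *+ 2 / n%:R : R),
    0 < cos (pi *+ 2 / n%:R : R) &
    s0 ^+ 2 * (2 - 2 * cos (pi *+ 2 / n%:R)) <= t ^+ 2].
Proof.
move=> s00 t0; pose eps := Num.min 1 (t ^+ 2 / (2 * s0 ^+ 2)).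
have s2 : 0 < s0 ^+ 2 by rewrite exprn_gt0.
have t2 : 0 < t ^+ 2 by rewrite exprn_gt0.
have eps0 : 0 < eps by rewrite lt_min ltr01 divr_gt0 // mulr_gt0.
have /cvgrPdist_lt/(_ _ eps0)/nbhs_ballP[d /= d0 dP] := @continuous_cos R 0.
pose d' := Num.min d 1.
have d'0 : 0 < d' by rewrite lt_min d0 ltr01.
pose n := (Num.truncn (pi *+ 2 / d' : R)).+1; exists n; set a := _ / _.
have n0 : 0 < n%:R :> R by rewrite ltr0n.
have pi0 := pi_gt0 R.
have a0 : 0 < a by rewrite divr_gt0 // mulrn_wgt0.
have ad : a < d'.
  rewrite /a ltr_pdivrMr // mulrC -ltr_pdivrMr //; exact: truncnS_gt.
move: ad; rewrite lt_min => /andP[ad a1].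
have := dP a; rewrite -ball_normE /ball_ /= sub0r normrN gtr0_norm // => /(_ ad).
rewrite cos0 lt_min => /andP[h1 h2].
have ca : 1 - cos a <= `|1 - cos a| by exact: ler_norm.
split => //; first by apply: sin_gt0_pi; rewrite a0; have := pi_ge2 R; lra.
  by lra.
have : `|1 - cos a| * (2 * s0 ^+ 2) < t ^+ 2 by rewrite -ltr_pdivlMr // mulr_gt0.
by nra.
Qed.

Section Enclosure.
Variables (R : realType) (Omega : set (plane R)) (p C r0 : R) (N : nat).
Implicit Types (x z e : plane R) (t : R).
Local Notation E := (boundary Omega).

Hypotheses (E0 : E !=set0) (p1 : 1 < p) (p2 : p < 2) (N0 : (0 < N)%N).
Hypotheses (C0 : 0 <= C) (CN : C <= N%:R).
Hypotheses (cm : boundary_meets_circles Omega r0) (lv : exits_disks Omega r0).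
Hypothesis oO : open Omega.
Hypothesis pO : forall x y, Omega x -> Omega y ->
  exists g : R -> plane R, [/\ path_in Omega g, g 0 = x & g 1 = y].
Hypothesis cc : curve_condition p C Omega.

(** A path in [Omega] is compact, so it keeps a positive distance from the
    complement. *)
Lemma path_away (b : R -> plane R) : path_in Omega b -> exists2 h, 0 < h &
  forall t z, 0 <= t <= 1 -> ~ Omega z -> 2 * h <= enorm (z - b t).
Proof.
move=> [/within_econt cb bO].
have cF : closed (~` Omega) by exact: open_closedC.
have F0 : ~` Omega !=set0 by have [z Ez] := E0; exists z; exact: boundary_out Ez.
have [c c01 cmin] := EVT_min ler01 (within_comp_lip (dist_continuous F0) cb).
rewrite in_itv /= in c01.
have h0 : 0 < dist_to (b c) (~` Omega) by apply: dist_gt0 => //; apply; exact: bO.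
exists (dist_to (b c) (~` Omega) / 2); first by rewrite divr_gt0.
move=> t z t01 nOz; rewrite enormBC mulrC divfK ?pnatr_eq0 //.
by apply: le_trans (cmin t _) (dist_le (b t) nOz); rewrite in_itv.
Qed.

(** Otherwise the curves joining boundary points near the vertices of a fine
    polygon inscribed in the circle would form a closed curve which stays close
    to the circle, hence winds around the points near [x], and which no path of
    [Omega] from such a point to a far point can cross. *)
Lemma enclosed_escape x (s0 t : R) : E x -> 0 < t -> 128 * N%:R * t <= r0 ->
  64 * N%:R * t <= s0 -> s0 <= 66 * N%:R * t ->
  (forall z, enorm (z - x) = s0 -> dist_to z E < t) ->
  exists e (g : R -> plane R) s, [/\ E e, enorm (e - x) < s0 + t,
    [/\ rectifiable g, g 0 = e, 0 <= s <= 1 & 16 * N%:R * t <= enorm (g s - e)] &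
    (line_integral g (dist_weight Omega p) <= (N%:R * (3 * t) `^ (2 - p))%:E)%E].
Proof.
move=> Ex t0 rr0 s0l s0u nearE.
have N1 : 1 <= N%:R :> R by rewrite ler1n.
have Nt : t <= N%:R * t by nra.
have s00 : 0 < s0 by nra.
have [n [n0 sn cn hn]] := fine_polygon s00 t0.
set a := _ / _ in sn cn hn.
pose y (i : nat) := circ x s0 (i%:R * a).
pose D (i : nat) := mkpt (cos (i%:R * a)) (sin (i%:R * a)).
have na : n%:R * a = pi *+ 2 by rewrite /a mulrC divfK // pnatr_eq0 -lt0n.
have Dn : D n = D 0%N by rewrite /D na mul0r cos2pi sin2pi cos0 sin0.
have yD i : y i = x + s0 *: D i by [].
have yn : y n = y 0%N by rewrite !yD Dn.
have yx i : enorm (y i - x) = s0 by apply: enorm_circ; exact: ltW.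
have Dstep i : sin (i.+1%:R * a - i%:R * a) = sin a /\ cos (i.+1%:R * a - i%:R * a) = cos a.
  by rewrite -mulrBl -natrB // subSnn mul1r.
have yy i : enorm (y i - y i.+1) <= t.
  rewrite -(@ler_pXn2r _ 2) ?nnegrE ?enorm_ge0 ?(ltW t0) //.
  by rewrite enormBC circ_dist ?(ltW s00) // (Dstep i).2.
have near z : exists e, enorm (z - x) = s0 -> E e /\ enorm (z - e) < t.
  have [zs|nzs] := pselect (enorm (z - x) = s0); last by exists 0.
  by have [e Ee ze] := dist_ltP E0 (nearE z zs); exists e.
have {near} [ch chP] := choice near.
pose e i := ch (y i).
have eP i : E (e i) /\ enorm (y i - e i) < t by exact: chP.
have en : e n = e 0%N by rewrite /e yn.
have ee i : enorm (e i - e i.+1) <= 3 * t.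
  have := enorm_tri (y i) (e i) (e i.+1).
  have := enorm_tri (y i.+1) (y i) (e i.+1).
  have := (eP i).2; have := (eP i.+1).2; have := yy i; rewrite (enormBC (e i) (y i)); lra.
have gex (i : nat) := cc (boundary_out oO (eP i).1) (boundary_out oO (eP i.+1).1).
have [g gP] := choice gex.
have gI i : (line_integral (g i) (dist_weight Omega p) <=
    (N%:R * (3 * t) `^ (2 - p))%:E)%E.
  have [_ _ _ _ h] := gP i; apply: le_trans h _; rewrite lee_fin.
  apply: ler_pM => //; first exact: powR_ge0.
  by apply: ge0_ler_powR (ee i); rewrite ?nnegrE ?enorm_ge0 ?subr_ge0 ?mulr_ge0 ?ltW.
have [[i [s [s01 far]]]|none] := pselect (exists i s, 0 <= s <= 1 /\
    16 * N%:R * t <= enorm (g i s - e i)).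
  have [rg _ g0 _ _] := gP i; exists (e i), (g i), s; split => //.
    by exact: (eP i).1.
  have := enorm_tri (y i) (e i) x; rewrite yx (enormBC (e i) (y i)).
  by have := (eP i).2; lra.
have close i s : 0 <= s <= 1 -> enorm (g i s - e i) < 16 * N%:R * t.
  by move=> s01; rewrite ltNge; apply/negP => h; apply: none; exists i, s.
exfalso.
have r1 : 0 < 16 * N%:R * t by nra.
have [a1 Oa1 a1x] : exists2 a, Omega a & enorm (a - x) < 16 * N%:R * t.
  by have [/closure_enormP/(_ _ r1)] := Ex.
have [b1 Ob1 b1x] := lv x.
have [b [[cb bO] b0 b1e]] := pO Oa1 Ob1.
have [h h0 hP] := path_away (conj cb bO).
have xe z i : enorm (z - e i) < 16 * N%:R * t ->
    enorm (z - y i) < 16 * N%:R * t + t.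
  by have := enorm_tri (e i) z (y i); have := (eP i).2; rewrite (enormBC (y i) (e i)); lra.
apply: (@cycle_meets_path R n e D g b (x - b1) h) => //.
- move=> i _; have [[/within_econt cgi _] _ g0 g1 _] := gP i; by split.
- move=> i _; have [ds dc] := Dstep i.
  have -> : cross (D i) (D i.+1) = sin a.
    by rewrite -ds sinB /cross !coordE; ring.
  have -> : dot (D i) (D i.+1) = cos a.
    by rewrite -dc cosB /dot !coordE; ring.
  by [].
- exact/within_econt.
- move=> i s u _ s01 u01; apply: hP => //.
  by have [_ gO _ _ _] := gP i; exact: gO.
- move=> i s _ s01; rewrite b0.
  have nD : enorm (s0 *: D i) = s0.
    by have := yx i; rewrite yD addrAC subrr add0r.
  suff : 0 < dot (s0 *: D i) (g i s - a1).
    rewrite (_ : dot _ _ = s0 * dot (D i) (g i s - a1)); last first.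
      by rewrite /dot !coordE; ring.
    by rewrite pmulr_rgt0.
  apply: dot_gt0_near; rewrite nD.
  have -> : g i s - a1 - s0 *: D i = (g i s - y i) + (x - a1).
    by rewrite yD; apply: plane_eq; rewrite !coordE; ring.
  have := enormD (g i s - y i) (x - a1); have := xe _ _ (close i s s01).
  by rewrite (enormBC x a1); nra.
- move=> i s _ s01; rewrite b1e; apply: dot_gt0_near.
  have -> : g i s - b1 - (x - b1) = (g i s - y i) + (y i - x).
    by apply: plane_eq; rewrite !coordE; ring.
  have := enormD (g i s - y i) (y i - x); have := xe _ _ (close i s s01).
  by rewrite (enormBC x b1) yx; nra.
Qed.

(** Either [N] circles about [x] all reach distance [t] from the boundary, or
    one of them does not, and then [enclosed_escape] supplies another centre
    from which a curve of the complement escapes. *)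
Lemma level_points_near x t : E x -> 0 < t -> 128 * N%:R * t <= r0 ->
  level_points Omega N t x (128 * N%:R * t).
Proof.
move=> Ex t0 rr0.
have N1 : 1 <= N%:R :> R by rewrite ler1n.
have Nt : t <= N%:R * t by nra.
pose s (k : nat) : R := 64 * N%:R * t + 2 * t * k%:R.
have sk k : (k < N)%N -> 64 * N%:R * t <= s k <= 66 * N%:R * t.
  move=> kN; have : k%:R <= N%:R :> R by rewrite ler_nat ltnW.
  have : 0 <= k%:R :> R by rewrite ler0n.
  by rewrite /s => k0 kN'; apply/andP; split; nra.
have [circ_far|] := pselect (forall k, (k < N)%N ->
    exists2 z, enorm (z - x) = s k & t <= dist_to z E).
  have lev k : exists q, (k < N)%N ->
      enorm (q - x) = s k /\ dist_to q E = 3 / 4 * t.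
    have [kN|_] := ltnP k N; last by exists 0.
    have [z zs dz] := circ_far k kN; have /andP[sk1 sk2] := sk k kN.
    have [||| q qz qd] := @level_on_circle R Omega E0 r0 t x z cm Ex t0.
    - by rewrite zs; nra.
    - by rewrite zs; nra.
    - by [].
    by exists q => _; rewrite qz zs.
  have [q qP] := choice lev; exists q; split.
    move=> k kN; have [-> ->] := qP k kN; split => //.
    by have /andP[_ ?] := sk k kN; nra.
  have sep k k' : (k < N)%N -> (k' < N)%N -> (k < k')%N -> 2 * t <= enorm (q k - q k').
    move=> kN k'N kk'; apply: le_trans (radial_separation (qP k kN).1 (qP k' k'N).1).
    rewrite distrC; apply: le_trans (ler_norm _).
    have : k.+1%:R <= k'%:R :> R by rewrite ler_nat.
    by rewrite /s -addn1 natrD; nra.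
  move=> k k' kN k'N; rewrite neq_ltn => /orP[] kk'; first exact: sep.
  by rewrite enormBC; exact: sep.
move=> /existsNP[k /not_implyP[kN nz]].
have /andP[sk1 sk2] := sk k kN.
have [|e [g [v [Ee ex [rg g0 v01 gv] Ig]]]] := enclosed_escape Ex t0 rr0 sk1 sk2.
  by move=> z zs; rewrite ltNge; apply/negP => dz; apply: nz; exists z.
have [|q [qP qsep]] := level_points_of_escape E0 p1 p2 N0 t0 cm Ee _ rg g0 v01 gv Ig.
  by nra.
exists q; split => // k' k'N; have [qe qd] := qP k' k'N; split => //.
by have := enorm_tri e (q k') x; nra.
Qed.

End Enclosure.

(** * Counting grid points near the boundary *)

Section Counting.
Variable R : realType.

Definition slab m (y : R) (L : nat) : {set 'I_m} :=
  [set i : 'I_m | `|(i : nat)%:R - y| <= L%:R]%SET.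

Lemma slab_card_ge m (y : R) (L : nat) : L%:R <= y -> y < m%:R ->
  (L <= #|slab m y L|)%N.
Proof.
move=> Ly ym; have y0 : 0 <= y by apply: le_trans Ly.
have /andP[ty yt] := Num.Theory.truncn_itv y0.
set k := Num.truncn y in ty yt.
have Lk : (L <= k)%N.
  by rewrite -ltnS -(ltr_nat R); exact: le_lt_trans yt.
have km : (k < m)%N by rewrite -(ltr_nat R); exact: le_lt_trans ym.
have lt j : (k - j < m)%N by lia.
pose f (j : 'I_L) : 'I_m := Ordinal (lt j).
rewrite -[X in (X <= _)%N](card_ord L) -cardsT.
rewrite -(@card_imset _ _ f); last first.
  move=> j j' [] jj'; apply/val_inj => /=.
  by have := ltn_ord j; have := ltn_ord j'; lia.
apply: subset_leq_card; apply/fintype.subsetP => _ /imsetP[j _ ->].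
have jL := ltn_ord j; have jk : (j <= k)%N by lia.
have jL' : (val j).+1%:R <= L%:R :> R by rewrite ler_nat.
rewrite inE /= natrB // ler_norml; move: jL' yt; rewrite -!natr1.
have : 0 <= (val j)%:R :> R by rewrite ler0n.
by move=> *; apply/andP; split; lra.
Qed.

Lemma slab_card_le m (c K : nat) : (#|slab m c%:R K| <= K.*2.+1)%N.
Proof.
rewrite -[X in (_ <= X)%N](card_ord K.*2.+1).
have close (i : 'I_m) : i \in slab m c%:R K -> (c <= i + K)%N /\ (i <= c + K)%N.
  rewrite inE ler_norml => /andP[h1 h2].
  by rewrite -!(ler_nat R) !natrD; split; lra.
rewrite -(@card_in_imset _ _ (fun i : 'I_m => inord (i + K - c) : 'I_K.*2.+1)).
  exact: max_card.
move=> i j /close[i1 i2] /close[j1 j2] /(congr1 (@nat_of_ord _)).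
by rewrite !inordK; [move=> ij; apply/val_inj => /=|..]; lia.
Qed.

(** The grid of mesh [h] on the square of half side [b * h]. *)
Definition grid m (b h : R) (ij : 'I_m * 'I_m) : plane R :=
  mkpt (((ij.1 : nat)%:R - b) * h) (((ij.2 : nat)%:R - b) * h).

Variables (Omega : set (plane R)) (N : nat) (b h : R) (m : nat).
Local Notation E := (boundary Omega).
Local Notation gp := (@grid m b h).

Definition near_pts (t : R) : {set 'I_m * 'I_m} :=
  [set ij | dist_to (gp ij) E <= t]%SET.

Lemma sum_disjoint_le (T : finType) (n : nat) (S : 'I_n -> {set T}) (A : {set T}) (k : nat) :
  (forall i, S i \subset A) -> (forall i j, i != j -> forall z, z \in S i -> z \in S j -> False) ->
  (forall i, (k <= #|S i|)%N) -> (n * k <= #|A|)%N.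
Proof.
move=> SA dS kS.
apply: (@leq_trans #|\bigcup_(i < n) S i|%SET); last first.
  by apply: subset_leq_card; apply/finset.bigcupsP.
rewrite -sum1_card partition_disjoint_bigcup; last first.
  move=> i j ij; rewrite finset.disjoints_subset; apply/fintype.subsetP => z zi.
  by rewrite inE; apply/negP; exact: dS zi.
rewrite -[X in (X * _)%N](card_ord n) -sum_nat_const.
by apply: leq_sum => i _; rewrite sum1_card.
Qed.

(** Passing from scale [t] to [t / 2] loses a fixed proportion of the grid
    points: each point of the [t]-neighbourhood has, within [256 * N * t], at
    least [N] disjoint squares of side [t / 8] made of points of the difference,
    and the points within [256 * N * t] of a point of the difference are at most
    of order [N ^ 2] times as many as those of one such square. *)
Lemma near_pts_decay (L : nat) (t : R) : E !=set0 -> (0 < L)%N -> (0 < N)%N ->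
  0 < h -> t = 16 * L%:R * h -> m%:R = 2 * b ->
  (forall x, E x -> level_points Omega N t x (128 * N%:R * t)) ->
  (forall x i, E x -> `|x 0 i| + 129 * N%:R * t <= b * h) ->
  (#|near_pts t| <= 2 ^ 28 * N * (#|near_pts t| - #|near_pts (t / 2)|))%N.
Proof.
move=> E0 L0 N0 h0 tE mb lev box.
have N1 : 1 <= N%:R :> R by rewrite ler1n.
have L1 : 1 <= L%:R :> R by rewrite ler1n.
have t0 : 0 < t by rewrite tE; nra.
pose band := near_pts t :\: near_pts (t / 2).
have cband : #|band| = (#|near_pts t| - #|near_pts (t / 2)|)%N.
  rewrite cardsD (finset.setIidPr _) //; apply/fintype.subsetP => ij; rewrite !inE => h1.
  by apply: le_trans h1 _; lra.
rewrite -cband.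
pose K := (2 ^ 12 * N * L)%N.
have KE : K%:R = 4096 * N%:R * L%:R :> R.
  by rewrite /K natrM natrM natrX; ring.
pose nbr (g : 'I_m * 'I_m) := finset.setX (slab m (g.1 : nat)%:R K) (slab m (g.2 : nat)%:R K).
have nbrC g g' : (g' \in nbr g) = (g \in nbr g').
  by rewrite !inE !(distrC (g.1%:R)) !(distrC (g.2%:R)).
have many g : g \in near_pts t -> (N * (L * L) <= #|nbr g :&: band|)%N.
  rewrite inE => dg; have [|x Ex gx] := @dist_ltP R (gp g) E (2 * t) E0; first by lra.
  have [q [qP qsep]] := lev x Ex.
  (* The grid coordinates of the point q k. *)
  pose y (k i : nat) : R := q k 0 (inord i) / h + b.
  have yE k i : (y k i - b) * h = q k 0 (inord i).
    by rewrite /y addrK divfK ?gt_eqF.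
  pose S (k : 'I_N) := finset.setX (slab m (y k 0%N) L) (slab m (y k 1%N) L).
  have i0 : inord 0 = 0 :> 'I_2 by apply/val_inj; rewrite /= inordK.
  have i1 : inord 1 = 1 :> 'I_2 by apply/val_inj; rewrite /= inordK.
  have Sclose k ij : ij \in S k -> enorm (gp ij - q k) <= t / 8.
    rewrite !inE => /andP[h1 h2].
    apply: le_trans (enorm_le_sum _) _; rewrite !coordE -i0 -i1.
    rewrite -!yE -!mulrBl !normrM !(ger0_norm (ltW h0)) !opprB !addrA !subrK.
    by rewrite tE; nra.
  have ybox k i : (k < N)%N -> (i < 2)%N -> L%:R <= y k i /\ y k i < m%:R.
    move=> kN i2; have [qx _] := qP k kN.
    have qi : `|q k 0 (inord i)| <= b * h - L%:R * h.
      have := box x (inord i) Ex.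
      have : `|q k 0 (inord i)| <= `|x 0 (inord i)| + enorm (q k - x).
        rewrite -[q k in X in X <= _](subrK x) coordD addrC.
        apply: le_trans (ler_normD _ _) _; rewrite lerD2l.
        case: i i2 => [|[|//]] _; rewrite ?i0 ?i1;
          [exact: coord0_le|exact: coord1_le].
      have : L%:R * h <= N%:R * t by rewrite tE; nra.
      lra.
    move: qi; rewrite -yE normrM (ger0_norm (ltW h0)) -mulrBl ler_pM2r // ler_norml.
    by rewrite mb => /andP[]; split; lra.
  apply: (@sum_disjoint_le _ N S).
  - move=> k; apply/fintype.subsetP => ij ijS; have kN := ltn_ord k.
    have [qx qd] := qP k kN; have c1 := Sclose k ij ijS.
    rewrite inE; apply/andP; split.
      have c2 : enorm (gp ij - gp g) <= 256 * N%:R * t.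
        have := enorm_tri (q k) (gp ij) (gp g); have := enorm_tri x (q k) (gp g).
        by rewrite (enormBC x (gp g)); nra.
      have c3 := le_trans (coord0_le _) c2; have c4 := le_trans (coord1_le _) c2.
      rewrite !inE KE; move: c3 c4; rewrite !coordE -!mulrBl !normrM.
      rewrite !(ger0_norm (ltW h0)) !opprB !addrA !subrK tE => c3 c4.
      rewrite -(ler_pM2r h0) -[X in _ && X](ler_pM2r h0).
      by apply/andP; split; lra.
    rewrite !inE -ltNge; apply/andP; split.
      have := dist_lip (q k) (gp ij) E0; rewrite qd enormBC; lra.
    by have := dist_lip (gp ij) (q k) E0; rewrite qd; lra.
  - move=> k k' kk' ij ijS ijS'.
    have := Sclose _ _ ijS; have := Sclose _ _ ijS'.
    have := qsep k k' (ltn_ord k) (ltn_ord k') kk'.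
    have := enorm_tri (gp ij) (q k) (q k'); rewrite (enormBC (q k) (gp ij)); lra.
  - move=> k; rewrite cardsX; apply: leq_mul.
      by have [] := ybox k 0%N (ltn_ord k) isT; exact: slab_card_ge.
    by have [] := ybox k 1%N (ltn_ord k) isT; exact: slab_card_ge.
have few g : (#|nbr g :&: near_pts t| <= K.*2.+1 * K.*2.+1)%N.
  apply: leq_trans (subset_leq_card (finset.subsetIl _ _)) _.
  by rewrite cardsX; apply: leq_mul; exact: slab_card_le.
(* Count the pairs of a point near the boundary and a point of the band within
   K steps of it in both coordinates. *)
have double : (#|near_pts t| * (N * (L * L)) <= #|band| * (K.*2.+1 * K.*2.+1))%N.
  rewrite -!sum_nat_const.
  apply: (@leq_trans (\sum_(g in near_pts t) \sum_(g' in band | g' \in nbr g) 1)).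
    apply: leq_sum => g gt; apply: leq_trans (many g gt) _.
    rewrite -sum1_card; apply: eq_leq; apply: eq_bigl => g'.
    by rewrite finset.in_setI andbC.
  rewrite (exchange_big_dep (mem band)) /=; last by move=> g g' _ /andP[].
  apply: leq_sum => g' g'b; apply: leq_trans (few g').
  rewrite -sum1_card; apply: eq_leq; apply: eq_bigl => g.
  by rewrite finset.in_setI g'b /= nbrC andbC.
have NL : (0 < N * (L * L))%N by rewrite !muln_gt0 N0 L0.
rewrite -(leq_pmul2r NL); apply: leq_trans double _.
rewrite [leqRHS]mulnAC [leqRHS]mulnC leq_mul2l; apply/orP; right.
have K1 : (0 < K)%N by rewrite /K muln_gt0 muln_gt0 expn_gt0 N0 L0.
apply: (@leq_trans ((2 ^ 2 * K) * (2 ^ 2 * K))); first by apply: leq_mul; lia.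
rewrite /K (_ : 28 = 2 + 12 + (2 + 12))%N // !expnD.
by apply: eq_leq; ring.
Qed.

End Counting.

(** * Hausdorff dimension *)

Section Dimension.
Variable R : realType.

Lemma hausdorff_gauge_ge0 (s : R) (U : set (plane R)) : (0 <= hausdorff_gauge s U)%E.
Proof. by rewrite /hausdorff_gauge; case: ifP => // _; exact: poweR_ge0. Qed.

Lemma hausdorff_content_ge0 (s d : R) (A : set (plane R)) :
  (0 <= hausdorff_content s d A)%E.
Proof.
apply: le_ereal_inf_tmp => _ [F _ <-]; apply: nneseries_ge0 => i _ _.
exact: hausdorff_gauge_ge0.
Qed.

(** A finite cover is padded with empty sets, whose gauge is 0. *)
Lemma hausdorff_content_le (T : finType) (U : T -> set (plane R)) (A : {set T})
    (s d r : R) (E : set (plane R)) : 0 <= s -> 0 <= r -> r <= d ->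
  (forall a, U a !=set0) -> (forall a x y, U a x -> U a y -> enorm (x - y) <= r) ->
  (forall x, E x -> exists2 a, a \in A & U a x) ->
  (hausdorff_content s d E <= (#|A|%:R * r `^ s)%:E)%E.
Proof.
move=> s0 r0 rd U0 Ur EU.
have diamU a : (diameter (U a) <= r%:E)%E.
  by apply: ge_ereal_sup => _ [x Ux [y Uy <-]]; rewrite lee_fin; exact: Ur Ux Uy.
pose F i := if [pick a in A | index a (enum A) == i] is Some a then U a else set0.
have Fsmall i : F i !=set0 -> (i < #|A|)%N.
  rewrite /F; case: pickP => [a /andP[aA /eqP <-] _|_ [z //]].
  by rewrite cardE index_mem mem_enum.
have gF i : (hausdorff_gauge s (F i) <= (if (i < #|A|)%N then r `^ s else 0)%:E)%E.
  rewrite /hausdorff_gauge; case: ifPn => [_|/set0P F0].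
    by rewrite lee_fin; case: ifP => // _; exact: powR_ge0.
  rewrite Fsmall // -poweR_EFin; move: F0; rewrite /F; case: pickP => [a _ _|_ [z //]].
  apply: gt0_ler_poweR => //.
    rewrite in_itv /= leey andbT; have [z Uz] := U0 a.
    apply: ereal_sup_ubound; exists z => //; exists z => //.
    by rewrite subrr enorm0.
  by rewrite in_itv /= leey andbT lee_fin.
apply: (@le_trans _ _ (\sum_(0 <= i <oo) hausdorff_gauge s (F i))%E).
  apply: ereal_inf_lbound; exists F => //; split.
    move=> i; rewrite /F; case: pickP => [a _|_].
      by apply: le_trans (diamU a) _; rewrite lee_fin.
    by apply: ge_ereal_sup => _ [x []].
  move=> x /EU[a aA Uax]; exists (index a (enum A)) => //.
  rewrite /F; case: pickP => [a' /andP[a'A /eqP ii]|/(_ a)]; last by rewrite aA eqxx.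
  suff -> : a' = a by [].
  have aE : a \in enum A by rewrite mem_enum.
  have a'E : a' \in enum A by rewrite mem_enum.
  by rewrite -(nth_index a a'E) ii nth_index.
apply: lime_le; first by apply: is_cvg_nneseries => i _ _; exact: hausdorff_gauge_ge0.
apply: nearW => n; apply: (@le_trans _ _
    (\sum_(0 <= i < n) (if (i < #|A|)%N then r `^ s else 0)%:E)%E).
  by apply: lee_sum => i _; exact: gF.
rewrite sumEFin lee_fin.
have -> : \sum_(0 <= i < n) (if (i < #|A|)%N then r `^ s else 0) =
    (minn n #|A|)%:R * r `^ s.
  elim: n => [|n IH]; first by rewrite big_geq // min0n mul0r.
  rewrite big_nat_recr //= IH; case: ifPn => [nA|]; last rewrite -leqNgt => nA.
    by rewrite (minn_idPl (ltnW nA)) (minn_idPl nA) -natr1 mulrDl mul1r.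
  by rewrite addr0 (minn_idPr nA) (minn_idPr (leqW nA)).
by apply: ler_wpM2r; [exact: powR_ge0|rewrite ler_nat geq_minr].
Qed.

End Dimension.

Lemma hausdorff_dim_le (R : realType) (s : R) (A : set (plane R)) : 0 <= s ->
  (forall d e, 0 < d -> 0 < e -> (hausdorff_content s d A <= e%:E)%E) ->
  (hausdorff_dim A <= s%:E)%E.
Proof.
move=> s0 sA; apply: ereal_inf_lbound; exists s => //; split => //.
apply/eqP; rewrite eq_le; apply/andP; split.
  apply: ge_ereal_sup => _ [d d0 <-]; apply/lee_addgt0Pr => e e0.
  by rewrite add0e; exact: sA.
apply: le_trans (hausdorff_content_ge0 s 1 A) _.
by apply: ereal_sup_ubound; exists 1 => //=; exact: ltr01.
Qed.

(** The loss of the factor [1 - c] at each halving of the scale beats the gain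
    of the factor [2 ^ (c / 2)] caused by the exponent [2 - c / 2]. *)
Lemma geometric_ratio (R : realType) (c : R) : 0 < c -> c <= 1 ->
  0 <= (1 - c) * 4 * 2^-1 `^ (2 - c / 2) < 1.
Proof.
move=> c0 c1; have a0 := powR_ge0 (2^-1 : R) (2 - c / 2).
apply/andP; split; first by rewrite !mulr_ge0 //; lra.
have h2 : 4 * 2^-1 `^ (2 - c / 2) <= expR (c / 2).
  have -> : (2^-1 : R) `^ (2 - c / 2) = 4^-1 * expR (c / 2 * ln 2).
    rewrite powRD; last by apply/implyP => _; rewrite invr_eq0 pnatr_eq0.
    rewrite powR_mulrn; last by rewrite invr_ge0 ler0n.
    rewrite (_ : 2^-1 ^+ 2 = 4^-1 :> R); last by field.
    rewrite /powR invr_eq0 pnatr_eq0 /= lnV ?posrE ?ltr0n //.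
    by congr (_ * expR _); ring.
  rewrite mulrA divff ?mul1r ?pnatr_eq0 // ler_expR.
  rewrite -[leRHS]mulr1; apply: ler_wpM2l; first by rewrite divr_ge0 // ltW.
  by have := @le_ln1Dx R 1; rewrite -(natr1 1) => ->.
have h1 : 1 - c <= expR (- c) by exact: expR_ge1Dx.
apply: (@le_lt_trans _ _ (expR (- c) * expR (c / 2))).
  by rewrite -mulrA; apply: ler_pM h1 h2; [lra|rewrite mulr_ge0].
by rewrite -expRD expR_lt1; lra.
Qed.

Section DimensionBound.
Variables (R : realType) (Omega : set (plane R)) (N : nat) (t0 B1 : R).
Local Notation E := (boundary Omega).

Definition scale_loss : R := (2 ^+ 28 * N%:R)^-1.
Local Notation c := scale_loss.

(** At the mesh [h0 / 2 ^ n] the decay is applied [n] times, from scale [t0] to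
    scale [t0 / 2 ^ n], which is 16 meshes.  The cells near the boundary then
    cover it, and there are at most [(1 - c) ^ n * 4 ^ n] of them up to a
    constant. *)
Lemma dim_of_level_points : E !=set0 -> (0 < N)%N -> 0 < t0 ->
  (forall x t, E x -> 0 < t -> t <= t0 ->
     level_points Omega N t x (128 * N%:R * t)) ->
  (forall x i, E x -> `|x 0 i| <= B1) ->
  (hausdorff_dim E <= (2 - c / 2)%:E)%E.
Proof.
move=> E0 N0 t0p lev EB.
have N1 : 1 <= N%:R :> R by rewrite ler1n.
have [D DE] : exists D : R, D = 2 ^+ 28 * N%:R by exists (2 ^+ 28 * N%:R).
have D1 : 1 <= D by rewrite DE mulr_ege1 // exprn_ege1 // ler1n.
have D0 : 0 < D by exact: lt_le_trans D1.
rewrite /c -DE.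
have c0 : 0 < D^-1 by rewrite invr_gt0.
have c1 : D^-1 <= 1 by rewrite invf_le1.
have B0 : 0 <= B1 by have [x Ex] := E0; apply: le_trans (EB x 0 Ex).
pose h0 := t0 / 16; have h0p : 0 < h0 by rewrite /h0; lra.
(* The grid square extends beyond the bounded set E by the radius in which the
   level points are found, with room for the squares around them. *)
pose b0 := (Num.truncn ((B1 + 129 * N%:R * t0) / h0)).+1.
have b0P : B1 + 129 * N%:R * t0 <= b0%:R * h0.
  by rewrite -ler_pdivrMr // ltW // truncnS_gt.
pose h n : R := h0 / 2 ^+ n; pose b n : R := b0%:R * 2 ^+ n.
pose m n := (2 * (b0 * 2 ^ n))%N.
have p2 n : 0 < 2 ^+ n :> R by rewrite exprn_gt0.
have hp n : 0 < h n by rewrite divr_gt0.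
have mb n : (m n)%:R = 2 * b n by rewrite /m /b !natrM natrX.
have bh n : b n * h n = b0%:R * h0.
  by rewrite /b /h; field; rewrite gt_eqF.
pose V n k := #|near_pts Omega (b n) (h n) (m n) (t0 / 2 ^+ k)|.
have tk k : 0 < t0 / 2 ^+ k <= t0.
  rewrite divr_gt0 //= ler_pdivrMr // ler_peMr ?(ltW t0p) //.
  by rewrite exprn_ege1 // ler1n.
have Vle n k : (k <= n)%N -> (V n k)%:R <= (1 - D^-1) ^+ k * ((m n) * (m n))%:R.
  elim: k => [_|k IH kn].
    rewrite expr0 mul1r ler_nat; apply: leq_trans (max_card _) _.
    by rewrite card_prod card_ord.
  have /andP[tk0 tkt] := tk k.
  have decay := @near_pts_decay R Omega N (b n) (h n) (m n) (2 ^ (n - k))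
    (t0 / 2 ^+ k) E0 _ N0 (hp n) _ (mb n).
  have {decay} : (V n k <= 2 ^ 28 * N * (V n k - V n k.+1))%N.
    rewrite /V (_ : t0 / 2 ^+ k.+1 = t0 / 2 ^+ k / 2); last first.
      by rewrite exprSr invfM mulrA.
    apply: decay; rewrite ?expn_gt0 //.
    - rewrite natrX /h /h0 -{2}(subnK (ltnW kn)) exprD.
      by field; rewrite !gt_eqF.
    - by move=> x Ex; exact: lev.
    - move=> x i Ex; rewrite bh; apply: le_trans b0P.
      by have := EB x i Ex; nra.
  have Vmono : (V n k.+1 <= V n k)%N.
    apply: subset_leq_card; apply/fintype.subsetP => ij; rewrite !inE => h1.
    apply: le_trans h1 _; rewrite exprSr invfM mulrA ler_pdivrMr //; lra.
  rewrite -(ler_nat R) natrM natrM natrX natrB // -DE => h1.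
  have h2 : D^-1 * (V n k)%:R <= (V n k)%:R - (V n k.+1)%:R.
    by rewrite mulrC ler_pdivrMr // mulrC.
  have IHk := IH (ltnW kn); rewrite exprS -mulrA.
  apply: (@le_trans _ _ ((1 - D^-1) * (V n k)%:R)); first by lra.
  by apply: ler_wpM2l; lra.
pose s : R := 2 - D^-1 / 2.
have s0 : 0 <= s by rewrite /s; lra.
pose K : R := (2 * b0%:R) ^+ 2 * (4 * h0) `^ s.
pose q : R := (1 - D^-1) * 4 * 2^-1 `^ s.
have content d n : 4 * h n <= d -> (hausdorff_content s d E <= (K * q ^+ n)%:E)%E.
  move=> hd; apply: (@le_trans _ _ ((V n n)%:R * (4 * h n) `^ s)%:E); last first.
    rewrite lee_fin.
    have -> : (4 * h n) `^ s = (4 * h0) `^ s * (2^-1 `^ s) ^+ n.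
      rewrite /h mulrA powRM ?mulr_ge0 ?invr_ge0 ?ltW //.
      by rewrite -exprVn -powR_mulrn ?invr_ge0 // powRAC powR_mulrn ?powR_ge0.
    apply: (@le_trans _ _ ((1 - D^-1) ^+ n * ((m n) * (m n))%:R *
        ((4 * h0) `^ s * (2^-1 `^ s) ^+ n))).
      apply: ler_wpM2r; last exact: Vle.
      by rewrite mulr_ge0 ?exprn_ge0 ?powR_ge0.
    rewrite natrM mb /b /K /q !exprMn (_ : 4 ^+ n = 2 ^+ n * 2 ^+ n :> R); last first.
      by rewrite -exprMn; congr (_ ^+ _); ring.
    by rewrite le_eqVlt; apply/orP; left; apply/eqP; ring.
  pose U (ij : 'I_(m n) * 'I_(m n)) : set (plane R) :=
    [set z | enorm (z - grid (b n) (h n) ij) <= 2 * h n].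
  apply: (@hausdorff_content_le R _ U (near_pts Omega (b n) (h n) (m n) (t0 / 2 ^+ n))) => //.
  - by rewrite mulr_ge0 // ltW.
  - by move=> ij; exists (grid (b n) (h n) ij); rewrite /U /= subrr enorm0 mulr_ge0 // ltW.
  - move=> ij x y; rewrite /U /= => xU yU.
    have := enorm_tri (grid (b n) (h n) ij) x y.
    by rewrite (enormBC (grid _ _ _) y); lra.
  - move=> x Ex.
    have cell i : exists j : 'I_(m n), `|x 0 i - ((j : nat)%:R - b n) * h n| <= h n.
      have xi := EB x i Ex.
      pose y := x 0 i / h n + b n.
      have yE : x 0 i = (y - b n) * h n by rewrite /y addrK divfK ?gt_eqF.
      have B1b : B1 < b n * h n by rewrite bh; apply: lt_le_trans b0P; nra.
      have : `|y - b n| < b n.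
        rewrite -(ltr_pM2r (hp n)) -{1}(ger0_norm (ltW (hp n))) -normrM -yE.
        exact: le_lt_trans B1b.
      rewrite ltr_norml => /andP[y1 y2].
      have y0 : 0 <= y by lra.
      have /andP[ty yt] := truncn_itv y0.
      have lt : (Num.truncn y < m n)%N.
        by rewrite -(ltr_nat R) mb; apply: le_lt_trans ty _; lra.
      exists (Ordinal lt) => /=; rewrite yE -mulrBl normrM (ger0_norm (ltW (hp n))).
      rewrite ler_piMl ?(ltW (hp n)) // ler_norml; move: yt; rewrite -natr1.
      by move=> yt; apply/andP; split; lra.
    have [i xi] := cell 0; have [j xj] := cell 1.
    have xij : enorm (x - grid (b n) (h n) (i, j)) <= 2 * h n.
      by apply: le_trans (enorm_le_sum _) _; rewrite !coordE /=; lra.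
    exists (i, j) => //; rewrite inE.
    have := @dist_le R (grid (b n) (h n) (i, j)) x E Ex.
    rewrite enormBC; have : t0 / 2 ^+ n = 16 * h n.
      by rewrite /h /h0; field; rewrite gt_eqF.
    by have := hp n; lra.
apply: hausdorff_dim_le => // d e d0 e0.
have [q0 q1] := andP (geometric_ratio c0 c1); rewrite -/s -/q in q0 q1.
have K0 : 0 <= K by rewrite mulr_ge0 ?exprn_ge0 ?powR_ge0 // mulr_ge0.
have cvq : (K * q ^+ n) @[n --> \oo] --> (0 : R).
  by apply: cvg_geometric; rewrite ger0_norm.
have cvh : (4 * h0 * 2^-1 ^+ n) @[n --> \oo] --> (0 : R).
  apply: cvg_geometric; rewrite ger0_norm ?invr_ge0 //.
  by rewrite invf_lt1 // ltr1n.
move/cvgrPdist_lt: cvq => /(_ e e0) cvq; move/cvgrPdist_lt: cvh => /(_ d d0) cvh.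
near \oo => n.
have qn : `|0 - K * q ^+ n| < e by near: n.
have hn : `|0 - 4 * h0 * 2^-1 ^+ n| < d by near: n.
apply: (@le_trans _ _ (K * q ^+ n)%:E).
  apply: content; move: hn; rewrite sub0r normrN /h exprVn mulrA.
  by move=> hn; apply: le_trans (ler_norm _) (ltW hn).
rewrite lee_fin; move: qn; rewrite sub0r normrN => qn.
exact: le_trans (ler_norm _) (ltW qn).
Unshelve. all: by end_near. Qed.

End DimensionBound.

Theorem theorem1p1 (R : realType) :
  exists M : R, 0 < M /\
    forall (p C : R) (Omega : set (plane R)),
      1 < p -> p < 2 -> 1 < C ->
      domain Omega -> bounded_set Omega -> simply_connected Omega ->
      curve_condition p C Omega ->
      (hausdorff_dim (boundary Omega) <= (2 - M / C)%:E)%E.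
Proof.
exists ((2 ^+ 30)^-1); split; first by rewrite invr_gt0 exprn_gt0.
move=> p C Omega p1 p2 C1 dO bO scO cc.
case: (dO) => O0 cO oO.
have [B OB] : exists B : R, forall z, Omega z -> `|z| <= B.
  have [B0 [_ HB]] := bO; exists (B0 + 1) => z Oz.
  by apply: (HB (B0 + 1)) => //; rewrite ltrDl.
have E0 := boundary_neq0 O0 OB.
have [r0 r00 lv] := exits_disks_ex O0 oO.
have cm := boundary_meets_circles_ex dO OB cc lv.
pose N := (Num.truncn C).+1.
have C0 : 0 <= C by lra.
have /andP[TC CT] := truncn_itv C0.
have N0 : (0 < N)%N by [].
have N1 : 1 <= N%:R :> R by rewrite ler1n.
have N2 : N%:R <= 2 * C by rewrite /N -natr1; lra.
pose t0 := r0 / (128 * N%:R).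
have t00 : 0 < t0 by rewrite divr_gt0 // mulr_gt0 // ltr0n.
have lev x t : boundary Omega x -> 0 < t -> t <= t0 ->
    level_points Omega N t x (128 * N%:R * t).
  move=> Ex tp tt0; apply: (@level_points_near R Omega p C r0 N) => //.
  - exact: ltW.
  - exact: scO.1.
  - by move: tt0; rewrite /t0 ler_pdivlMr ?mulr_gt0 ?ltr0n // mulrC.
have EB x i : boundary Omega x -> `|x 0 i| <= B + 1.
  move=> [/closure_enormP/(_ 1 ltr01)[y Oy yx] _].
  have h1 := coord_le_norm (y - x) i; have h2 := norm_le_enorm (y - x).
  have h3 := le_trans (coord_le_norm y i) (OB y Oy).
  have : `|x 0 i| <= `|y 0 i| + `|(y - x) 0 i|.
    by rewrite coordB distrC -[X in `|X| <= _](subrKC (y 0 i)) ler_normD.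
  lra.
apply: le_trans (dim_of_level_points E0 N0 t00 lev EB) _.
rewrite lee_fin lerD2l lerN2 /scale_loss.
have ta : 0 < 2 ^+ 28 :> R by rewrite exprn_gt0.
rewrite (_ : 2 ^+ 30 = 4 * 2 ^+ 28 :> R); last by ring.
rewrite -!invfM lef_pV2 ?posrE; [nra|nra|nra].
Qed.
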